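(* Let $(\tau,X)$ be a pair of (generally correlated) real random variables with $\tau>0$ almost surely, and let $S(\cdot)$ be the associated renewal-reward process. Assume that $\mathbb{E}\exp(\varepsilon X^2-\tau)<\infty$ for some $\varepsilon>0$, and that $\mathbb{E}X=0$, $\mathbb{E}X^2=1$, $\mathbb{E}\tau=1$. For $\lambda\in\mathbb{R}$ let $\eta_\lambda$ be the unique number in $[0,\infty)$ with $\mathbb{E}\exp(\lambda X-\eta_\lambda\tau)=1$. Then \[ \eta_\lambda=\tfrac12\lambda^2+o(\lambda^2)\quad\text{as }\lambda\to0, \] and, whenever $0<C<\infty$, \[ \frac1t\ln\mathbb{E}\exp\bigl(\lambda S(t)\bigr)=\eta_\lambda+O\Bigl(\frac1t\Bigr)\quad\text{as }t\to\infty, \] uniformly in $\lambda\in[-C,C]$; that is, there exist $T,K\in(0,\infty)$ such that $\bigl|\frac1t\ln\mathbb{E}\exp(\lambda S(t))-\eta_\lambda\bigr|\le K/t$ for all $t\ge T$ and all $\lambda\in[-C,C]$.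
   Context: Renewal-reward process: let $(\tau_1,X_1),(\tau_2,X_2),\dots$ be independent copies of the pair $(\tau,X)$. For $t\ge 0$, $S(t)=X_1+\dots+X_n$ whenever $\tau_1+\dots+\tau_n\le t<\tau_1+\dots+\tau_{n+1}$, $n=0,1,2,\dots$ (empty sums are $0$). This defines $S(t)$ for all $t\ge0$ almost surely. Under the stated hypotheses, for every $\lambda\in\mathbb{R}$ there exists exactly one $\eta_\lambda\in[0,\infty)$ with $\mathbb{E}\exp(\lambda X-\eta_\lambda\tau)=1$; this is the $\eta_\lambda$ of the claim. *)

(* Defs.v *)
From HB Require Import structures.
From mathcomp Require Import all_boot all_order all_algebra finmap.
From mathcomp Require Import all_classical all_reals all_analysis.

Set Implicit Arguments.
Unset Strict Implicit.
Unset Printing Implicit Defensive.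

Import Order.TTheory GRing.Theory Num.Theory.
Import numFieldNormedType.Exports.

Local Open Scope classical_set_scope.
Local Open Scope ring_scope.

Definition mutually_independent d d' (T : measurableType d)
    (T' : measurableType d') (R : realType) (P : probability T R)
    (I : choiceType) (Y : I -> T -> T') : Prop :=
  forall (J : {fset I}) (A : I -> set T'),
    (forall i, measurable (A i)) ->
    P (\bigcap_(i in [set` J]) (Y i @^-1` A i))
      = (\prod_(i <- J) P (Y i @^-1` A i))%E.

Definition same_law d1 d2 d' (T1 : measurableType d1) (T2 : measurableType d2)
    (T' : measurableType d') (R : realType)
    (P1 : probability T1 R) (P2 : probability T2 R)
    (Y1 : T1 -> T') (Y2 : T2 -> T') : Prop :=
  forall A : set T', measurable A -> P1 (Y1 @^-1` A) = P2 (Y2 @^-1` A).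

(* The copies may live on another probability space than the original pair. *)
Definition independent_copies d1 d2 d' (T1 : measurableType d1)
    (T2 : measurableType d2) (T' : measurableType d') (R : realType)
    (P1 : probability T1 R) (P2 : probability T2 R)
    (Y : T1 -> T') (Ys : nat -> T2 -> T') : Prop :=
  mutually_independent P2 Ys /\ forall n, same_law P2 P1 (Ys n) Y.

Section renewal_reward.
Context {T : Type} {R : realType} (taus Xs : nat -> T -> R).

(* Indices start at 0: taus i and Xs i stand for tau_{i+1} and X_{i+1}. *)
Definition renewal_count_is (t : R) (w : T) (n : nat) : bool :=
  \sum_(i < n) taus i w <= t < \sum_(i < n.+1) taus i w.

(* When all taus i w are positive there is at most one n as required (see
   renewal_rewardE). The least n and the default 0 only make the definition
   total; they matter on a null set only. *)
Definition renewal_reward (t : R) (w : T) : R :=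
  match pselect (exists n, renewal_count_is t w n) with
  | left exn => \sum_(i < ex_minn exn) Xs i w
  | right _ => 0
  end.

Lemma renewal_rewardE (t : R) (w : T) (n : nat) :
  (forall i, 0 < taus i w) -> renewal_count_is t w n ->
  renewal_reward t w = \sum_(i < n) Xs i w.
Proof.
move=> tau_gt0 tn; rewrite /renewal_reward; case: pselect => [exn|[]]; last first.
  by exists n.
case: ex_minnP => m /andP[_ tm] /(_ _ tn); rewrite leq_eqVlt.
move=> /predU1P[->//|mn]; move: tn => /andP[nt _].
suff : \sum_(i < m.+1) taus i w <= \sum_(i < n) taus i w.
  by move=> /le_trans/(_ nt); rewrite leNgt tm.
rewrite -(big_mkord xpredT (fun i => taus i w)).
rewrite -(big_mkord xpredT (fun i => taus i w)).
rewrite (big_cat_nat (leq0n _) mn)/= lerDl.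
by apply: sumr_ge0 => i _; exact: ltW.
Qed.

End renewal_reward.

(* Main.v *)
Require Import Defs.
From mathcomp Require Import finmap.
From HB Require Import structures.
From mathcomp Require Import all_boot all_order all_algebra.
From mathcomp Require Import all_classical all_reals all_analysis.
From mathcomp Require Import measurable_realfun.
From mathcomp Require Import ring lra.

Set Implicit Arguments.
Unset Strict Implicit.
Unset Printing Implicit Defensive.

Import Order.TTheory GRing.Theory Num.Theory.
Import numFieldNormedType.Exports.

Local Open Scope classical_set_scope.
Local Open Scope ring_scope.

(** Write m(l, e) = E exp (l X - e tau).

    The exponent. In e, the function m(l, .) is strictly decreasing where it is
    finite, continuous on the positive half-line and tends to 0, so it takes the
    value 1 at most once, and it does so as soon as it exceeds 1 somewhere
    (normalizing_exists); for l = 0 the root is 0. That it exceeds 1 near e = 0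
    when l <> 0, and the asymptotics of the root, follow from one computation:
    writing exp y = 1 + y + y ^ 2 q(y) with q continuous and q(0) = 1/2, and
    taking y = l X - a l ^ 2 tau,
      m(l, a l ^ 2) = 1 + l ^ 2 (E [(X - a l tau) ^ 2 q(y)] - a),
    where the expectation tends to E X ^ 2 / 2 = 1/2 by dominated convergence
    (mgf_taylor, second_order_cvg). Hence for small l the point a l ^ 2 lies
    below eta_l if a < 1/2 and above it if a > 1/2. The domination comes from
    the exponential moment (tilt_domination): if tau >= eps X ^ 2 / 2 then
    a l ^ 2 tau absorbs |l X|, and otherwise
    exp (eps X ^ 2 - tau) >= exp (eps X ^ 2 / 2) dominates everything.
    Convexity of exp then carries the information from small l to every compact
    set: there eta_l >= a l ^ 2 with a > 0, so that
    (1 + tau) exp (l X - eta_l tau) has one integrable majorant.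

    The growth. Let T_n and S_n be the partial sums, M_n = exp (l S_n - eta_l T_n)
    and A_n(h) = E [M_n h(t - T_n)]. Then exp (- eta_l t) E exp (l S(t)) is the
    sum over n of the expectations of M_n exp (- eta_l (t - T_n)) on the events
    T_n <= t < T_{n+1}, and it has to be bounded from both sides, uniformly in t
    and in l. Independence gives A_{n+1}(h) = A_n(K h), where
    K h(u) = E [exp (l X - eta_l tau) h(u - tau)], so that the sum over n of the
    A_n(h) is at most v(t) whenever v >= h + K v (sum_tilted_le_super).
    - Let c > 0 be a lower bound of 1 - E exp (l X - (eta_l + 1) tau). An
      explicit v shows that the tilted walk spends a mass of at most
      (1 + b) / c in a window of length b (occupation_le); averaging over an
      independent copy of tau in the place of b yields the upper bound
      (sum_crossings_le).
    - For the lower bound, the tilted walk passes t with total mass 1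
      (alive_subsolution). Choose b such that u < b implies P (tau > u) >= p,
      while {tau > b} is so improbable that, by uniform integrability, passing t
      from a distance of b or more has mass at most 1/4. The remaining mass sits
      at distances u < b, where the untilted step passes t with probability at
      least p (sum_crossings_ge). *)

(** * Integration against a probability measure *)

Lemma integral_probability_cst d (T : measurableType d) (R : realType)
  (P : probability T R) (x : \bar R) : (\int[P]_w x = x)%E.
Proof.
by rewrite -[RHS]mule1 -[in RHS](probability_setT P); exact: integral_cst.
Qed.

Lemma measurable_natr_bool d (T : measurableType d) (R : realType) (b : T -> bool) :
  measurable_fun setT b -> measurable_fun setT (fun x => (b x)%:R : R).
Proof.
move=> mb; rewrite (_ : (fun x => _) = (fun x => if b x then 1 else 0)).
  by apply: measurable_fun_ifT => //; exact: measurable_cst.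
by apply/funext => x; case: (b x).
Qed.

Lemma measurable_bool_set d (T : measurableType d) (b : T -> bool) :
  measurable_fun setT b -> measurable [set x | b x].
Proof.
move=> mb; have : measurable [set true] by [].
by move=> /(mb measurableT); rewrite setTI.
Qed.

Section integral_ae.
Context d (T : measurableType d) (R : realType) (P : probability T R).

Lemma integrable_ae_le (f g : T -> R) : measurable_fun setT f ->
  P.-integrable setT (EFin \o g) -> {ae P, forall x, `|f x| <= g x} ->
  P.-integrable setT (EFin \o f).
Proof.
move=> mf /integrableP[mg ig] fg; apply/integrableP; split.
  exact/measurable_EFinP.
apply: le_lt_trans ig; apply: ae_ge0_le_integral => //.
- by apply: measurableT_comp => //; exact/measurable_EFinP.
- exact: measurableT_comp.
- apply: filterS fg => x fgx _ /=; rewrite lee_fin.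
  exact: le_trans fgx (ler_norm _).
Qed.

Lemma ae_le_Rintegral (f g : T -> R) : P.-integrable setT (EFin \o f) ->
  P.-integrable setT (EFin \o g) -> {ae P, forall x, f x <= g x} ->
  \int[P]_x f x <= \int[P]_x g x.
Proof.
move=> fi gi fg; rewrite -subr_ge0 -RintegralB// /Rintegral fine_ge0//.
have /integrableP[mgf _] : P.-integrable setT (EFin \o (fun x => g x - f x)).
  exact: (integrableB measurableT gi fi).
have -> : (\int[P]_x (g x - f x)%:E = \int[P]_x `|(g x - f x)%:E|)%E.
  apply: ae_eq_integral => //; first exact: measurableT_comp.
  apply: filterS fg => x fgx _ /=; rewrite ger0_norm// subr_ge0//.
exact: integral_ge0.
Qed.

(** A nonnegative function with zero integral vanishes almost everywhere,
    which contradicts positivity because the whole space is not null. *)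
Lemma Rintegral_gt0 (g : T -> R) : P.-integrable setT (EFin \o g) ->
  {ae P, forall x, 0 < g x} -> 0 < \int[P]_x g x.
Proof.
move=> gi g0; rewrite lt_neqAle; apply/andP; split; last first.
  have -> : 0 = \int[P]_x (cst 0 x) :> R by rewrite /Rintegral integral0.
  apply: ae_le_Rintegral => //.
    exact: (finite_measure_integrable_cst P 0 (A := setT)).
  by apply: filterS g0 => x /ltW.
apply/eqP => /esym gint0.
have /integrableP[mg _] := gi.
have gE : (\int[P]_x `|(g x)%:E| = 0)%E.
  rewrite -[RHS]/(0%R%:E) -gint0 /Rintegral fineK; last first.
    exact: integrable_fin_num.
  apply: ae_eq_integral => //; first exact: measurableT_comp.
  by apply: filterS g0 => x gx _ /=; rewrite gtr0_norm.
have /(ae_eq_integral_abs P measurableT mg) [N [mN N0 Nsub]] := gE.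
have [M [mM M0 Msub]] := g0.
have : P setT = 0%E.
  apply: (subset_measure0 (B := M `|` N)) => //; first exact: measurableU.
    move=> x _; have [gx|gx] := pselect (0 < g x); last by left; apply: Msub.
    right; apply: Nsub => /= /(_ Logic.I) [gx0]; by rewrite gx0 ltxx in gx.
  exact: etrans (measureU0 mM mN N0) M0.
by rewrite probability_setT => /eqP; rewrite onee_eq0.
Qed.

End integral_ae.

(** * Chains driven by independent steps *)

(** Uniqueness of product measures, applied to the law of the pair restricted
    to an event E: this keeps track of further independent events while the
    pair is formed. *)
Lemma product_pair_law d d1 d2 (Omega : measurableType d)
    (T1 : measurableType d1) (T2 : measurableType d2) (R : realType)
    (P : probability Omega R) (m2 : {sigma_finite_measure set T2 -> \bar R})
    (Z : {mfun Omega >-> T1}) (W : {mfun Omega >-> T2}) (E : set Omega) :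
  measurable E ->
  (forall A B, measurable A -> measurable B ->
    P (Z @^-1` A `&` W @^-1` B `&` E) = (P (Z @^-1` A) * m2 B)%E) ->
  forall C, measurable C ->
  P ((fun w => (Z w, W w)) @^-1` C `&` E) = (distribution P Z \x m2)%E C.
Proof.
move=> mE ZWE C mC.
have mZW : measurable_fun setT (fun w => (Z w, W w)) by exact: measurable_fun_pair.
pose m' := measure_function_pushforward__canonical__measure_function_Measure
  (mrestr P mE) mZW.
by rewrite (@product_measure_unique _ _ _ _ _ _ _ m').
Qed.

Lemma indep_pair_law d d1 d2 (Omega : measurableType d)
    (T1 : measurableType d1) (T2 : measurableType d2) (R : realType)
    (P : probability Omega R) (Z : {mfun Omega >-> T1}) (W : {mfun Omega >-> T2}) :
  (forall A B, measurable A -> measurable B ->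
    P (Z @^-1` A `&` W @^-1` B) = (P (Z @^-1` A) * P (W @^-1` B))%E) ->
  forall C, measurable C ->
  P ((fun w => (Z w, W w)) @^-1` C) = (distribution P Z \x distribution P W)%E C.
Proof.
move=> ZW C mC; rewrite -(@product_pair_law _ _ _ _ _ _ _ P _ Z W setT)//.
  by rewrite setIT.
by move=> A B mA mB; rewrite setIT ZW.
Qed.

Section independent_chain.
Local Open Scope ereal_scope.
Context d d1 d2 (Omega : measurableType d) (T1 : measurableType d1)
  (T2 : measurableType d2) (R : realType) (P : probability Omega R).
Context (Y : nat -> {mfun Omega >-> T2}) (f : T1 * T2 -> T1) (z0 : T1).
Hypothesis mf : measurable_fun setT f.
Hypothesis indepY : mutually_independent P (fun n => Y n : Omega -> T2).

Fixpoint chain n (w : Omega) : T1 :=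
  if n is m.+1 then f (chain m w, Y m w) else z0.

Lemma measurable_chain n : measurable_fun setT (chain n).
Proof.
elim: n => [|n IHn] /=; first exact: measurable_cst.
by apply: (measurableT_comp mf); exact: measurable_fun_pair.
Qed.

HB.instance Definition _ n :=
  isMeasurableFun.Build _ _ _ _ (chain n) (measurable_chain n).

(** Cylinder events in the inputs, to be used with J inside [n, oo) when the
    chain is observed at time n. *)
Definition later_event (J : {fset nat}) (B : nat -> set T2) : set Omega :=
  \bigcap_(j in [set` J]) Y j @^-1` B j.

Lemma later_event1 n B : later_event [fset n]%fset B = Y n @^-1` B n.
Proof.
rewrite /later_event (_ : [set` [fset n]%fset] = [set n]) ?bigcap_set1//.
by apply/seteqP; split=> j /=; rewrite inE => /eqP.
Qed.

Lemma measurable_later_event J B : (forall j, measurable (B j)) ->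
  measurable (later_event J B).
Proof.
move=> mB; rewrite /later_event bigcap_fset.
apply: bigsetI_measurable => j _.
by rewrite -[X in measurable X]setTI; exact: measurable_funP.
Qed.

(** Independence is known for finitely many inputs at a time, not between a
    function of the past and the future. Induction on n bridges this: the next
    state is a function of the pair (state, input), whose law restricted to a
    later event is a product measure by the induction hypothesis. *)
Lemma chain_indep_later n (J : {fset nat}) (A : set T1) (B : nat -> set T2) :
  (forall j, j \in J -> (n <= j)%N) -> measurable A ->
  (forall j, measurable (B j)) ->
  P (chain n @^-1` A `&` later_event J B) =
  P (chain n @^-1` A) * P (later_event J B).
Proof.
elim: n J A B => [|n IHn] J A B nJ mA mB /=.
  have [z0A|z0A] := pselect (A z0).
    have -> : (fun=> z0) @^-1` A = [set: Omega] by apply/seteqP; split=> w _.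
    by rewrite setTI probability_setT mul1e.
  have -> : (fun=> z0) @^-1` A = set0 :> set Omega by apply/seteqP; split=> w.
  by rewrite set0I measure0 mul0e.
have mE := measurable_later_event J mB.
pose E := later_event J B.
pose nngE : {nonneg R} := NngNum (fine_ge0 (measure_ge0 P E)).
have PE : P E = nngE%:num%:E by rewrite /= fineK// fin_num_measure.
have key C : measurable C ->
    P ((fun w => (chain n w, Y n w)) @^-1` C `&` E) =
    (distribution P (chain n) \x mscale nngE (distribution P (Y n))) C.
  apply: product_pair_law => // A' B' mA' mB'.
  rewrite -setIA.
  (* The event on Y n is merged into the later event, as J does not contain
     n. *)
  pose B2 j := if j == n then B' else B j.
  have mB2 j : measurable (B2 j) by rewrite /B2; case: ifP.
  have B2n : B2 n = B' by rewrite /B2 eqxx.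
  have nJn : n \notin J by apply/negP => /nJ; rewrite ltnn.
  have EJ : E = later_event J B2.
    apply: eq_bigcapr => j /= jJ; rewrite /B2 ifF//.
    by apply/negbTE; apply: contra nJn => /eqP <-.
  have -> : Y n @^-1` B' `&` E = later_event (n |` J)%fset B2.
    by rewrite EJ /later_event bigcap_fsetU1 B2n.
  rewrite IHn//; last first.
    by move=> j; rewrite in_fset1U => /predU1P[->//|/nJ/ltnW].
  congr (_ * _).
  rewrite /later_event indepY// big_fsetU1//= B2n -indepY//.
  rewrite -/(later_event J B2) -EJ PE.
  by rewrite /mscale muleC.
have mfA : measurable (f @^-1` A) by rewrite -[X in measurable X]setTI; exact: mf.
have keyA := key _ mfA.
rewrite -/E [LHS]keyA.
have -> : P ((fun w => f (chain n w, Y n w)) @^-1` A) =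
    (distribution P (chain n) \x distribution P (Y n)) (f @^-1` A).
  rewrite -(indep_pair_law (P := P))// => A' B' mA' mB'.
  by rewrite -(later_event1 n (fun=> B')) IHn// => j; rewrite inE => /eqP ->.
rewrite /product_measure1 PE muleC -ge0_integralZl//.
exact: measurable_fun_xsection.
Qed.

Lemma chain_next_law n C : measurable C ->
  P ((fun w => (chain n w, Y n w)) @^-1` C) =
  (distribution P (chain n) \x distribution P (Y n)) C.
Proof.
apply: indep_pair_law => A B mA mB.
rewrite -(later_event1 n (fun=> B)) chain_indep_later//.
by move=> j; rewrite inE => /eqP ->.
Qed.

(** Since the state is independent of the next input, the latter may be
    replaced by an independent copy living on another probability space. *)
Lemma integral_chain_next d0 (Omega0 : measurableType d0)
    (P0 : probability Omega0 R) (Y0 : {mfun Omega0 >-> T2}) n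
    (F : T1 * T2 -> \bar R) :
  same_law P P0 (Y n) Y0 -> measurable_fun setT F -> (forall z, 0 <= F z) ->
  \int[P]_w F (chain n w, Y n w) = \int[P]_w \int[P0]_v F (chain n w, Y0 v).
Proof.
move=> YY0 mF F0.
have mZY : measurable_fun setT (fun w => (chain n w, Y n w)).
  exact: measurable_fun_pair.
pose m' := measure_function_pushforward__canonical__measure_function_Measure
  P mZY.
transitivity (\int[m']_z F z).
  by rewrite ge0_integral_pushforward.
rewrite (eq_measure_integral (distribution P (chain n) \x distribution P (Y n))%E).
  2: by move=> C mC _; exact: chain_next_law.
rewrite fubini_tonelli1// ge0_integral_distribution//; last 2 first.
- exact: measurable_fun_fubini_tonelli_F.
- by move=> x; apply: integral_ge0.
apply: eq_integral => w _; rewrite /fubini_F/=.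
rewrite (eq_measure_integral (distribution P0 Y0)); last first.
  by move=> C mC _; exact: YY0.
by rewrite ge0_integral_distribution//; exact: measurable_fun_pair2.
Qed.

End independent_chain.

(** * Tilted sums along the walk *)

Section renewal.
Context (R : realType) d0 (Omega0 : measurableType d0) (P0 : probability Omega0 R)
  (tau X : {RV P0 >-> R}) d (Omega : measurableType d) (P : probability Omega R)
  (taus Xs : nat -> {RV P >-> R}).
Hypothesis copies : independent_copies P0 P
     (fun w => (tau w, X w)) (fun n w => (taus n w, Xs n w)).

Definition arrival n w := \sum_(i < n) taus i w.
Definition reward n w := \sum_(i < n) Xs i w.

Lemma measurable_arrival n : measurable_fun setT (arrival n).
Proof. by apply: measurable_sum => i; exact: measurable_funP. Qed.

Lemma measurable_reward n : measurable_fun setT (reward n).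
Proof. by apply: measurable_sum => i; exact: measurable_funP. Qed.

Let pair0 : {mfun Omega0 >-> (R * R)%type} :=
  mfun_Sub (mem_set (measurable_fun_pair (measurable_funPT tau) (measurable_funPT X))).

Let pairs n : {mfun Omega >-> (R * R)%type} :=
  mfun_Sub (mem_set
    (measurable_fun_pair (measurable_funPT (taus n)) (measurable_funPT (Xs n)))).

Let add_pair (z : (R * R) * (R * R)) : R * R := (z.1.1 + z.2.1, z.1.2 + z.2.2).

Let measurable_add_pair : measurable_fun setT add_pair.
Proof.
apply: measurable_fun_pair; apply: measurable_funD; apply: measurableT_comp => //.
Qed.

Let chain_arrival_reward n w :
  chain pairs add_pair (0, 0) n w = (arrival n w, reward n w).
Proof.
elim: n => [|n IHn] /=; first by rewrite /arrival /reward !big_ord0.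
by rewrite IHn /arrival /reward !big_ord_recr.
Qed.

Lemma integral_next_step n (F : (R * R) * (R * R) -> \bar R) :
  measurable_fun setT F -> (forall z, 0 <= F z)%E ->
  (\int[P]_w F ((arrival n w, reward n w), (taus n w, Xs n w)) =
   \int[P]_w \int[P0]_v F ((arrival n w, reward n w), (tau v, X v)))%E.
Proof.
move=> mF F0; have [indep same] := copies.
under eq_integral do rewrite -chain_arrival_reward.
under [RHS]eq_integral do under eq_integral do rewrite -chain_arrival_reward.
have sameY : same_law P P0 (pairs n) pair0 by exact: same.
exact: (@integral_chain_next _ _ _ _ _ _ _ _ pairs _ _ measurable_add_pair indep
  _ _ _ _ _ _ sameY mF F0).
Qed.

Definition tilt (lam eta a x : R) : R := expR (lam * x - eta * a).

Lemma tilt_ge0 lam eta a x : 0 <= tilt lam eta a x.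
Proof. exact: expR_ge0. Qed.

Lemma tiltD lam eta a b x y :
  tilt lam eta (a + b) (x + y) = tilt lam eta a x * tilt lam eta b y.
Proof. by rewrite /tilt -expRD; congr expR; ring. Qed.

Lemma measurable_tilt lam eta d' (T : measurableType d') (a x : T -> R) :
  measurable_fun setT a -> measurable_fun setT x ->
  measurable_fun setT (fun w => tilt lam eta (a w) (x w)).
Proof.
move=> ma mx; apply: measurableT_comp; first exact: measurable_expR.
by apply: measurable_funB; apply: measurable_funM => //; exact: measurable_cst.
Qed.

Section tilted.
Variables (lam eta t : R).
Local Open Scope ereal_scope.

Let M n w := (tilt lam eta (arrival n w) (reward n w))%:E.
Let m0 v := (tilt lam eta (tau v) (X v))%:E.

(** A_n(h) in the notation of the introduction; u = t - T_n is the time that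
    is left when n steps have been made. *)
Definition tilted_sum n (h : R -> \bar R) : \bar R :=
  \int[P]_w (M n w * h (t - arrival n w)%R).

(** The transition operator K of the tilted walk, acting on functions of the
    time that is left. *)
Definition tilted_step (h : R -> \bar R) (u : R) : \bar R :=
  \int[P0]_v (m0 v * h (u - tau v)%R).

Let measurable_M n : measurable_fun setT (M n).
Proof.
by apply/measurable_EFinP; apply: measurable_tilt;
  [exact: measurable_arrival|exact: measurable_reward].
Qed.

Let measurable_m0 : measurable_fun setT m0.
Proof. by apply/measurable_EFinP; exact: measurable_tilt. Qed.

Let measurable_u n : measurable_fun setT (fun w => t - arrival n w)%R.
Proof.
by apply: measurable_funB; [exact: measurable_cst|exact: measurable_arrival].
Qed.

Lemma measurable_tilted_summand n h : measurable_fun setT h ->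
  measurable_fun setT (fun w => M n w * h (t - arrival n w)%R).
Proof.
move=> mh; apply: emeasurable_funM; first exact: measurable_M.
by apply: (measurableT_comp mh); exact: measurable_u.
Qed.

Lemma measurable_tilted_step h : measurable_fun setT h -> (forall u, 0 <= h u) ->
  measurable_fun setT (tilted_step h).
Proof.
move=> mh h0.
apply: (@measurable_fun_fubini_tonelli_F _ _ _ _ _ P0
  (fun z : R * Omega0 => m0 z.2 * h (z.1 - tau z.2)%R)).
  apply: emeasurable_funM; first exact: (measurableT_comp measurable_m0).
  apply: (measurableT_comp mh); apply: measurable_funB => //.
  exact: measurableT_comp.
by move=> z; rewrite mule_ge0// lee_fin tilt_ge0.
Qed.

(** Conditioning on the first n steps. *)
Lemma integral_next_pair n (e : R * R -> R -> \bar R) :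
  measurable_fun setT (fun z : (R * R) * R => e z.1 z.2) ->
  (forall y u, 0 <= e y u) ->
  \int[P]_w (M n w * e (taus n w, Xs n w) (t - arrival n w)%R) =
  tilted_sum n (fun u => \int[P0]_v e (tau v, X v) u).
Proof.
move=> me e0.
pose F z := (tilt lam eta z.1.1 z.1.2)%:E * e z.2 (t - z.1.1)%R.
transitivity (\int[P]_w F ((arrival n w, reward n w), (taus n w, Xs n w))) => //.
rewrite integral_next_step.
- apply: eq_integral => w _; rewrite /F/= ge0_integralZl//.
  + exact: (measurableT_comp me (measurable_fun_pair (measurable_fun_pair
      (measurable_funPT tau) (measurable_funPT X)) (measurable_cst (t - arrival n w)%R))).
  + by rewrite lee_fin tilt_ge0.
- apply: emeasurable_funM.
    by apply/measurable_EFinP; apply: measurable_tilt; exact: measurableT_comp.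
  exact: (measurableT_comp me (measurable_fun_pair measurable_snd
    (measurable_funB (measurable_cst t)
      (measurableT_comp measurable_fst measurable_fst)))).
- by move=> z; rewrite mule_ge0// lee_fin tilt_ge0.
Qed.

(** The same expectation with the next step fixed first; it turns bounds that
    hold for each value of the step into bounds for a random step. *)
Lemma integral_next_pair_swap n (e : R * R -> R -> \bar R) :
  measurable_fun setT (fun z : (R * R) * R => e z.1 z.2) ->
  (forall y u, 0 <= e y u) ->
  \int[P]_w (M n w * e (taus n w, Xs n w) (t - arrival n w)%R) =
  \int[P0]_v tilted_sum n (e (tau v, X v)).
Proof.
move=> me e0; rewrite integral_next_pair// /tilted_sum.
have mF : measurable_fun setT
    (fun z : Omega * Omega0 => M n z.1 * e (tau z.2, X z.2) (t - arrival n z.1)%R).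
  apply: emeasurable_funM; first exact: (measurableT_comp (measurable_M n)).
  exact: (measurableT_comp me (measurable_fun_pair (measurable_fun_pair
    (measurableT_comp (measurable_funPT tau) measurable_snd)
    (measurableT_comp (measurable_funPT X) measurable_snd))
    (measurableT_comp (measurable_u n) measurable_fst))).
rewrite -(fubini_tonelli _ mF)//; last first.
  by move=> z; rewrite mule_ge0// lee_fin tilt_ge0.
apply: eq_integral => w _; rewrite /= ge0_integralZl//.
+ exact: (measurableT_comp me (measurable_fun_pair (measurable_fun_pair
    (measurable_funPT tau) (measurable_funPT X)) (measurable_cst (t - arrival n w)%R))).
+ by rewrite lee_fin tilt_ge0.
Qed.

Lemma tilted_sum0 h : measurable_fun setT h -> tilted_sum 0 h = h t.
Proof.
move=> mh; rewrite /tilted_sum (eq_integral (fun=> h t)).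
  exact: integral_probability_cst.
move=> w _; rewrite /M /arrival /reward !big_ord0 /tilt !mulr0 subr0 expR0.
by rewrite mul1e subr0.
Qed.

Lemma tilted_sumS n h : measurable_fun setT h -> (forall u, 0 <= h u) ->
  tilted_sum n.+1 h = tilted_sum n (tilted_step h).
Proof.
move=> mh h0.
rewrite -(@integral_next_pair n
   (fun y u => (tilt lam eta y.1 y.2)%:E * h (u - y.1)%R)).
- apply: eq_integral => w _; rewrite /M /arrival /reward !big_ord_recr/=.
  by rewrite tiltD EFinM -muleA opprD addrA.
- apply: emeasurable_funM.
    by apply/measurable_EFinP; apply: measurable_tilt; exact: measurableT_comp.
  apply: (measurableT_comp mh); apply: measurable_funB => //.
  exact: measurableT_comp.
- by move=> y u; rewrite mule_ge0// lee_fin tilt_ge0.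
Qed.

Lemma tilted_sum_ge0 n h : (forall u, 0 <= h u) -> 0 <= tilted_sum n h.
Proof.
by move=> h0; apply: integral_ge0 => w _; rewrite mule_ge0// lee_fin tilt_ge0.
Qed.

Lemma tilted_step_ge0 h u : (forall u, 0 <= h u) -> 0 <= tilted_step h u.
Proof.
by move=> h0; apply: integral_ge0 => w _; rewrite mule_ge0// lee_fin tilt_ge0.
Qed.

Lemma le_tilted_sum n h k : measurable_fun setT h -> measurable_fun setT k ->
  (forall u, 0 <= h u) -> (forall u, h u <= k u) ->
  tilted_sum n h <= tilted_sum n k.
Proof.
move=> mh mk h0 hk; apply: ge0_le_integral => //.
- by move=> w _; rewrite mule_ge0// lee_fin tilt_ge0.
- exact: measurable_tilted_summand.
- exact: measurable_tilted_summand.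
- by move=> w _; rewrite lee_pmul2l ?lte_fin ?expR_gt0.
Qed.

Lemma tilted_sumD n h k : measurable_fun setT h -> measurable_fun setT k ->
  (forall u, 0 <= h u) -> (forall u, 0 <= k u) ->
  tilted_sum n (fun u => h u + k u) = tilted_sum n h + tilted_sum n k.
Proof.
move=> mh mk h0 k0; rewrite /tilted_sum -ge0_integralD//.
- by apply: eq_integral => w _; rewrite ge0_muleDr.
- by move=> w _; rewrite mule_ge0// lee_fin tilt_ge0.
- exact: measurable_tilted_summand.
- by move=> w _; rewrite mule_ge0// lee_fin tilt_ge0.
- exact: measurable_tilted_summand.
Qed.

Lemma tilted_sumZ n (c : R) h : (0 <= c)%R -> measurable_fun setT h ->
  (forall u, 0 <= h u) ->
  tilted_sum n (fun u => c%:E * h u) = c%:E * tilted_sum n h.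
Proof.
move=> c0 mh h0; rewrite /tilted_sum -ge0_integralZl//.
- by apply: eq_integral => w _; rewrite muleCA.
- exact: measurable_tilted_summand.
- by move=> w _; rewrite mule_ge0// lee_fin tilt_ge0.
Qed.

(** The maximum principle: a supersolution v of v = h + K v dominates the
    potential of h, because A_n(v) decreases by at least A_n(h) at each step. *)
Lemma sum_tilted_le_super (h v : R -> \bar R) N :
  measurable_fun setT h -> measurable_fun setT v ->
  (forall u, 0 <= h u) -> (forall u, 0 <= v u) ->
  (forall u, h u + tilted_step v u <= v u) ->
  \sum_(n < N) tilted_sum n h + tilted_sum N v <= v t.
Proof.
move=> mh mv h0 v0 hv; elim: N => [|N IHN].
  by rewrite big_ord0 add0e tilted_sum0.
apply: le_trans IHN; rewrite big_ord_recr/= -addeA; apply: leeD2l.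
rewrite tilted_sumS// -tilted_sumD//; last 2 first.
- exact: measurable_tilted_step.
- by move=> u; exact: tilted_step_ge0.
apply: le_tilted_sum => //.
- by apply: emeasurable_funD => //; exact: measurable_tilted_step.
- by move=> u; rewrite adde_ge0// tilted_step_ge0.
Qed.

Lemma sum_tilted_ge_sub (h v : R -> \bar R) N :
  measurable_fun setT h -> measurable_fun setT v ->
  (forall u, 0 <= h u) -> (forall u, 0 <= v u) ->
  (forall u, v u <= h u + tilted_step v u) ->
  v t <= \sum_(n < N) tilted_sum n h + tilted_sum N v.
Proof.
move=> mh mv h0 v0 hv; elim: N => [|N IHN].
  by rewrite big_ord0 add0e tilted_sum0.
apply: (le_trans IHN); rewrite big_ord_recr/= -addeA; apply: leeD2l.
rewrite tilted_sumS// -tilted_sumD//; last 2 first.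
- exact: measurable_tilted_step.
- by move=> u; exact: tilted_step_ge0.
apply: le_tilted_sum => //.
by apply: emeasurable_funD => //; exact: measurable_tilted_step.
Qed.

End tilted.
End renewal.

(** * Occupation of windows and passage over a level *)

Section ramp.
Context {R : realType}.
Implicit Types b u s : R.

(** A supersolution for the indicator of [0, b): increasing, with slope 1 on
    the window, constant above it, and exponential below 0 so that steps which
    leave the window still lose a definite amount. *)
Definition ramp b u : R := if u < 0 then expR u else 1 + Num.min u b.

Definition window b u : R := (0 <= u < b)%R%:R.

Lemma ramp_ge0 b u : 0 <= b -> 0 <= ramp b u.
Proof.
move=> b0; rewrite /ramp; case: ltP => u0; first exact: expR_ge0.
by rewrite addr_ge0// le_min u0.
Qed.

Lemma ramp_le b u : 0 <= b -> ramp b u <= 1 + b.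
Proof.
move=> b0; rewrite /ramp; case: ltP => u0.
  by apply: (@le_trans _ _ 1); [rewrite expR_le1 ltW|rewrite lerDl].
by rewrite lerD2l ge_min lexx orbT.
Qed.

(** The loss over a step s from inside the window is at least 1 - exp (- s).
    If the step stays above 0 the loss is s itself; if it lands below 0, the
    inequality u >= exp (- s) (exp u - 1) is used, valid because s > u. *)
Lemma ramp_decrease b u s : 0 <= b -> 0 < s ->
  window b u + ramp b (u - s) <= ramp b u + window b u * expR (- s).
Proof.
move=> b0 s0; rewrite /ramp /window.
have es := expR_ge1Dx (- s).
case: (ltP u 0) => u0 /=.
  by rewrite ifT ?mul0r ?add0r ?addr0 ?ler_expR; lra.
case: (ltP (u - s) 0) => us0.
- have e1 : expR (u - s) <= 1 by rewrite expR_le1 ltW.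
  case: (ltP u b) => ub /=.
  + rewrite !mul1r.
    have -> : expR (u - s) = expR (- s) * expR u by rewrite -expRD addrC.
    have eu := expR_ge1Dx (- u).
    have eu1 : expR (- u) * expR u = 1 by rewrite -expRD addNr expR0.
    have esu : expR (- s) <= expR (- u) by rewrite ler_expR; lra.
    have e1u : 1 <= expR u by rewrite -expR0 ler_expR.
    have := expR_gt0 u; have := expR_gt0 (- s); nra.
  + by rewrite mul0r; lra.
- case: (ltP u b) => ub /=.
  + by rewrite min_l ?mul1r; lra.
  + rewrite mul0r; have : Num.min (u - s) b <= b by rewrite ge_min lexx orbT.
    by lra.
Qed.

Lemma measurable_ramp b : measurable_fun setT (ramp b).
Proof.
apply: measurable_fun_ifT.
- by apply: measurable_fun_ltr => //; exact: measurable_cst.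
- exact: measurable_expR.
- apply: measurable_funD; first exact: measurable_cst.
  by apply: measurable_minr => //; exact: measurable_cst.
Qed.

Lemma measurable_window b : measurable_fun setT (window b).
Proof.
apply: measurable_natr_bool; apply: measurable_and.
  by apply: measurable_fun_ler => //; exact: measurable_cst.
by apply: measurable_fun_ltr => //; exact: measurable_cst.
Qed.

End ramp.

Section occupation.
Context (R : realType) d0 (Omega0 : measurableType d0) (P0 : probability Omega0 R)
  (tau X : {RV P0 >-> R}) d (Omega : measurableType d) (P : probability Omega R)
  (taus Xs : nat -> {RV P >-> R}).
Hypothesis copies : independent_copies P0 P
     (fun w => (tau w, X w)) (fun n w => (taus n w, Xs n w)).
Hypothesis tau_gt0 : {ae P0, forall w, 0 < tau w}.
Variables (lam eta c : R).
Hypothesis c_gt0 : 0 < c.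
Let m0 v := tilt lam eta (tau v) (X v).
Hypothesis m0_mass : (\int[P0]_v (m0 v)%:E = 1)%E.
Hypothesis m0_decay : (\int[P0]_v (m0 v * expR (- tau v))%:E <= (1 - c)%:E)%E.
Local Open Scope ereal_scope.

Notation tsum := (tilted_sum taus Xs lam eta).
Notation tstep := (tilted_step tau X lam eta).

Let measurable_m0 : measurable_fun setT m0.
Proof. exact: measurable_tilt. Qed.

Let m0_ge0 v : (0 <= m0 v)%R.
Proof. exact: tilt_ge0. Qed.

Lemma integral_tilt_cst (k : R) : (0 <= k)%R -> \int[P0]_v (m0 v * k)%:E = k%:E.
Proof.
move=> k0; under eq_integral do rewrite mulrC EFinM.
rewrite ge0_integralZl//; first by rewrite m0_mass mule1.
  exact/measurable_EFinP.
by move=> v _; rewrite lee_fin.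
Qed.

(** Averaging the loss under the tilted law, which has mass 1, gives at least
    c, the defect of the tilted Laplace transform of tau at 1. *)
Lemma ramp_supersolution b u : (0 <= b)%R ->
  (c * window b u)%:E + tstep (fun u => (ramp b u)%:E) u <= (ramp b u)%:E.
Proof.
move=> b0; set i : R := window b u.
have i0 : (0 <= i)%R by by rewrite /i /window ler0n.
have mramp : measurable_fun setT (fun v => ramp b (u - tau v)).
  apply: (measurableT_comp (measurable_ramp b)).
  by apply: measurable_funB => //; exact: measurable_cst.
have mdecay : measurable_fun setT (fun v => expR (- tau v)).
  apply: measurableT_comp; first exact: measurable_expR.
  exact: measurableT_comp.
have key : \int[P0]_v (m0 v * (i + ramp b (u - tau v)))%:E <=
           \int[P0]_v (m0 v * (ramp b u + i * expR (- tau v)))%:E.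
  apply: ae_ge0_le_integral => //.
  - by move=> v _; rewrite lee_fin mulr_ge0// addr_ge0// ramp_ge0.
  - apply/measurable_EFinP; apply: measurable_funM => //.
    by apply: measurable_funD => //; exact: measurable_cst.
  - move=> v _; rewrite lee_fin mulr_ge0// addr_ge0 ?ramp_ge0// mulr_ge0//.
  - apply/measurable_EFinP; apply: measurable_funM => //.
    apply: measurable_funD; first exact: measurable_cst.
    by apply: measurable_funM => //; exact: measurable_cst.
  - apply: filterS tau_gt0 => v tau0 _; rewrite lee_fin ler_wpM2l//.
    exact: ramp_decrease.
have -> : tstep (fun u => (ramp b u)%:E) u =
    \int[P0]_v (m0 v * ramp b (u - tau v))%:E.
  by apply: eq_integral => v _; rewrite EFinM.
have splitl : \int[P0]_v (m0 v * (i + ramp b (u - tau v)))%:E =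
    i%:E + \int[P0]_v (m0 v * ramp b (u - tau v))%:E.
  rewrite -(integral_tilt_cst i0) -ge0_integralD//.
  - by apply: eq_integral => v _; rewrite mulrDr EFinD.
  - by move=> v _; rewrite lee_fin mulr_ge0.
  - apply/measurable_EFinP; apply: measurable_funM => //; exact: measurable_cst.
  - by move=> v _; rewrite lee_fin mulr_ge0// ramp_ge0.
  - by apply/measurable_EFinP; exact: measurable_funM.
have splitr : \int[P0]_v (m0 v * (ramp b u + i * expR (- tau v)))%:E =
    (ramp b u)%:E + i%:E * \int[P0]_v (m0 v * expR (- tau v))%:E.
  rewrite -(integral_tilt_cst (ramp_ge0 u b0)) -ge0_integralZl//; last 2 first.
  - by apply/measurable_EFinP; exact: measurable_funM.
  - by move=> v _; rewrite lee_fin mulr_ge0// expR_ge0.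
  rewrite -ge0_integralD//.
  - apply: eq_integral => v _.
    by rewrite mulrDr EFinD -EFinM; congr (_ + _%:E); ring.
  - by move=> v _; rewrite lee_fin mulr_ge0// ramp_ge0.
  - apply/measurable_EFinP; apply: measurable_funM => //; exact: measurable_cst.
  - by move=> v _; rewrite -EFinM lee_fin !mulr_ge0// expR_ge0.
  - apply: emeasurable_funM; first exact: measurable_cst.
    by apply/measurable_EFinP; exact: measurable_funM.
move: key; rewrite splitl splitr => key.
have {}key := le_trans key (leeD2l (ramp b u)%:E (lee_wpmul2l (i0 : 0 <= i%:E) m0_decay)).
move: key; rewrite -EFinM -EFinD.
have : 0 <= \int[P0]_v (m0 v * ramp b (u - tau v))%:E.
  by apply: integral_ge0 => v _; rewrite lee_fin mulr_ge0// ramp_ge0.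
case: (\int[P0]_v (m0 v * ramp b (u - tau v))%:E) => [r| |]//.
by rewrite -!EFinD !lee_fin => _; lra.
Qed.

Lemma occupation_le t b N : (0 <= b)%R ->
  \sum_(n < N) tsum t n (fun u => (window b u)%:E) <= ((1 + b) / c)%:E.
Proof.
move=> b0.
have mw : measurable_fun setT (fun u => (window b u)%:E).
  by apply/measurable_EFinP; exact: measurable_window.
have := @sum_tilted_le_super _ _ _ P0 tau X _ _ P taus Xs copies lam eta t
  (fun u => c%:E * (window b u)%:E) (fun u => (ramp b u)%:E) N.
have -> : \sum_(n < N) tsum t n (fun u => c%:E * (window b u)%:E) =
    c%:E * \sum_(n < N) tsum t n (fun u => (window b u)%:E).
  rewrite ge0_sume_distrr//; last by move=> n _; apply: tilted_sum_ge0 => u; rewrite lee_fin ler0n.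
  apply: eq_bigr => n _; apply: tilted_sumZ => //; first exact: ltW.
  by move=> u; rewrite lee_fin ler0n.
move=> /(_ _ _ _ _ (fun u => ramp_supersolution u b0)) h.
rewrite EFinM muleC lee_pdivlMl//.
apply: (@le_trans _ _ (ramp b t)%:E); last by rewrite lee_fin ramp_le.
apply: le_trans (h _ _ _ _).
- by apply: leeDl; apply: tilted_sum_ge0 => u; rewrite lee_fin ramp_ge0.
- by apply: emeasurable_funM => //; exact: measurable_cst.
- by apply/measurable_EFinP; exact: measurable_ramp.
- by move=> u; rewrite -EFinM lee_fin mulr_ge0 ?ler0n// ltW.
- by move=> u; rewrite lee_fin ramp_ge0.
Qed.

Lemma measurable_next_pair_sum t n (e : R * R -> R -> \bar R) :
  measurable_fun setT (fun z : (R * R) * R => e z.1 z.2) ->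
  (forall y u, 0 <= e y u) ->
  measurable_fun setT (fun v => tsum t n (e (tau v, X v))).
Proof.
move=> me e0.
pose f z := (tilt lam eta (arrival taus n z.1) (reward Xs n z.1))%:E *
  e (tau z.2, X z.2) (t - arrival taus n z.1)%R.
apply: (@measurable_fun_fubini_tonelli_G _ _ _ _ _ P f).
- apply: emeasurable_funM.
    apply/measurable_EFinP; apply: measurable_tilt.
      exact: (measurableT_comp (measurable_arrival taus n) measurable_fst).
    exact: (measurableT_comp (measurable_reward Xs n) measurable_fst).
  exact: (measurableT_comp me (measurable_fun_pair (measurable_fun_pair
    (measurableT_comp (measurable_funPT tau) measurable_snd)
    (measurableT_comp (measurable_funPT X) measurable_snd))
    (measurable_funB (measurable_cst t)
      (measurableT_comp (measurable_arrival taus n) measurable_fst)))).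
- by move=> z; rewrite mule_ge0// lee_fin tilt_ge0.
Qed.

Lemma measurable_window_pair :
  measurable_fun setT (fun z : (R * R) * R => window z.1.1 z.2).
Proof.
apply: measurable_natr_bool; apply: measurable_and.
  by apply: measurable_fun_ler => //; exact: measurable_cst.
by apply: measurable_fun_ltr => //; exact: measurableT_comp.
Qed.

(** Passing t at step n means that t - T_n lies in the window [0, tau_{n+1});
    the next step is independent of T_n, so the occupation bound applies with
    its length as b. *)
Lemma sum_crossings_le t (k : R * R -> R) N :
  measurable_fun setT k -> (forall y, 0 <= k y)%R ->
  \sum_(n < N) \int[P]_w ((tilt lam eta (arrival taus n w) (reward Xs n w))%:E *
      (k (taus n w, Xs n w) * window (taus n w) (t - arrival taus n w))%:E) <=
  \int[P0]_v (k (tau v, X v) * ((1 + `|tau v|) / c))%:E.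
Proof.
move=> mk k0.
pose e (y : R * R) (u : R) := (k y * window y.1 u)%:E.
have me : measurable_fun setT (fun z : (R * R) * R => e z.1 z.2).
  apply/measurable_EFinP; apply: measurable_funM; last exact: measurable_window_pair.
  exact: (measurableT_comp mk).
have e0 y u : 0 <= e y u by rewrite lee_fin mulr_ge0// ler0n.
under eq_bigr => n _ do rewrite (integral_next_pair_swap copies lam eta t n me e0).
rewrite -ge0_integral_sum//; last 2 first.
- by move=> n; exact: measurable_next_pair_sum.
- by move=> n v _; exact: tilted_sum_ge0.
apply: ae_ge0_le_integral => //.
- by move=> v _; apply: sume_ge0 => n _; exact: tilted_sum_ge0.
- by apply: emeasurable_sum => n; exact: measurable_next_pair_sum.
- by move=> v _; rewrite lee_fin mulr_ge0// divr_ge0// ?addr_ge0// ltW.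
- apply/measurable_EFinP; apply: measurable_funM.
    exact: (measurableT_comp mk (measurable_fun_pair
      (measurable_funPT tau) (measurable_funPT X))).
  apply: measurable_funM; last exact: measurable_cst.
  apply: measurable_funD; first exact: measurable_cst.
  exact: measurableT_comp.
- apply: filterS tau_gt0 => v tau0 _; rewrite (gtr0_norm tau0).
  have mw : measurable_fun setT (fun u => (window (tau v) u)%:E).
    by apply/measurable_EFinP; exact: measurable_window.
  rewrite EFinM; apply: le_trans (lee_wpmul2l _ (occupation_le t N (ltW tau0))).
    rewrite ge0_sume_distrr//; last first.
      by move=> n _; apply: tilted_sum_ge0 => u; rewrite lee_fin ler0n.
    apply: lee_sum => n _; rewrite -tilted_sumZ//.
    by move=> u; rewrite lee_fin ler0n.
  by rewrite lee_fin.
Qed.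

(** exp is an eigenfunction of the tilted walk, with eigenvalue at most 1 - c
    < 1. This is how the walk is seen to leave every half-line. *)
Lemma tilted_sum_expR t n :
  tsum t n (fun u => (expR u)%:E) <= ((1 - c) ^+ n * expR t)%:E.
Proof.
have mexp : measurable_fun setT (fun u : R => (expR u)%:E).
  by apply/measurable_EFinP; exact: measurable_expR.
have e0 (u : R) : 0 <= (expR u)%:E by rewrite lee_fin expR_ge0.
have c1 : (0 <= 1 - c)%R.
  rewrite -lee_fin; apply: le_trans m0_decay; apply: integral_ge0 => v _.
  by rewrite lee_fin mulr_ge0// expR_ge0.
have mdecay : measurable_fun setT (fun v => m0 v * expR (- tau v))%R.
  apply: measurable_funM => //.
  apply: measurableT_comp; first exact: measurable_expR.
  exact: measurableT_comp.
elim: n => [|n IHn]; first by rewrite tilted_sum0// expr0 mul1r.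
rewrite (tilted_sumS copies)//.
apply: (@le_trans _ _ (tsum t n (fun u => (1 - c)%:E * (expR u)%:E))).
  apply: le_tilted_sum.
  - exact: measurable_tilted_step.
  - by apply: emeasurable_funM => //; exact: measurable_cst.
  - by move=> u; exact: tilted_step_ge0.
  - move=> u; apply: le_trans (lee_wpmul2r (e0 u) m0_decay).
    rewrite muleC -ge0_integralZl//; last 2 first.
    + exact/measurable_EFinP.
    + by move=> v _; rewrite lee_fin mulr_ge0// expR_ge0.
    rewrite le_eqVlt; apply/orP; left; apply/eqP; apply: eq_integral => v _.
    by rewrite expRD -!EFinM; congr (_%:E); rewrite -/(m0 v); ring.
rewrite tilted_sumZ// exprS -mulrA EFinM.
by apply: lee_wpmul2l => //; rewrite lee_fin.
Qed.

Definition alive (u : R) : R := (0 <= u)%R%:R.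

Lemma measurable_alive : measurable_fun setT alive.
Proof.
apply: measurable_natr_bool.
by apply: measurable_fun_ler => //; exact: measurable_cst.
Qed.

Let exit_fun (u : R) := \int[P0]_v (m0 v * window (tau v) u)%:E.

Let measurable_exit_fun : measurable_fun setT exit_fun.
Proof.
apply: (@measurable_fun_fubini_tonelli_F _ _ _ _ _ P0
  (fun z : R * Omega0 => (m0 z.2 * window (tau z.2) z.1)%:E)).
  apply/measurable_EFinP; apply: measurable_funM.
    exact: (measurableT_comp measurable_m0).
  apply: measurable_natr_bool; apply: measurable_and.
    by apply: measurable_fun_ler => //; exact: measurable_cst.
  by apply: measurable_fun_ltr => //; exact: measurableT_comp.
by move=> z; rewrite lee_fin mulr_ge0// ler0n.
Qed.

(** At u >= 0 the next step either passes the level or leaves nonnegative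
    time. *)
Lemma alive_subsolution u :
  (alive u)%:E <= exit_fun u + tstep (fun u => (alive u)%:E) u.
Proof.
have a0 : (0 <= alive u)%R by rewrite ler0n.
have mwin : measurable_fun setT (fun v => window (tau v) u).
  apply: measurable_natr_bool; apply: measurable_and; first exact: measurable_cst.
  by apply: measurable_fun_ltr => //; exact: measurable_cst.
have mal : measurable_fun setT (fun v => alive (u - tau v)).
  apply: (measurableT_comp measurable_alive).
  by apply: measurable_funB => //; exact: measurable_cst.
rewrite -(integral_tilt_cst a0) -ge0_integralD//; first last.
- by apply/measurable_EFinP; exact: measurable_funM.
- by move=> v _; rewrite mule_ge0// lee_fin ?ler0n ?tilt_ge0.
- by apply/measurable_EFinP; exact: measurable_funM.
- by move=> v _; rewrite lee_fin mulr_ge0// ler0n.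
apply: ge0_le_integral => //.
- by move=> v _; rewrite lee_fin mulr_ge0.
- by apply/measurable_EFinP; apply: measurable_funM => //; exact: measurable_cst.
- apply: emeasurable_funD; apply/measurable_EFinP; exact: measurable_funM.
- move=> v _; rewrite -EFinM -EFinD lee_fin -/(m0 v) -mulrDr ler_wpM2l//.
  rewrite /alive /window; case: (lerP 0 u) => u0 /=; last by rewrite addr_ge0// ler0n.
  by case: (ltP u (tau v)) => uv /=; rewrite ?lerDl ?ler0n// add0r subr_ge0 uv.
Qed.

(** The mass that passes t is 1 in total; at most 1/4 has not passed after N
    steps, at most 1/4 passes from a distance of at least b, so at least 1/2
    is accounted for by visits to the window [0, b), from where an untilted
    step passes with probability at least p. *)
Lemma sum_crossings_ge t b p : (0 <= t)%R -> (0 <= b)%R -> (0 <= p)%R ->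
  (forall u, (0 <= u < b)%R -> p%:E <= P0 [set v | (u < tau v)%R]) ->
  \int[P0]_v (m0 v * (b < tau v)%R%:R * ((1 + `|tau v|) / c))%:E <= (4^-1)%:E ->
  exists N, (p / 2)%:E <= \sum_(n < N)
    \int[P]_w ((tilt lam eta (arrival taus n w) (reward Xs n w))%:E *
      (window b (t - arrival taus n w) *
       (t - arrival taus n w < taus n w)%R%:R)%:E).
Proof.
move=> t0 b0 p0 Hp Hbad.
have mw : measurable_fun setT (fun u => (window b u)%:E).
  by apply/measurable_EFinP; exact: measurable_window.
have mal : measurable_fun setT (fun u => (alive u)%:E).
  by apply/measurable_EFinP; exact: measurable_alive.
have [N HN] : exists N, tsum t N (fun u => (alive u)%:E) <= (4^-1)%:E.
  have c1 : (0 <= 1 - c)%R.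
    rewrite -lee_fin; apply: le_trans m0_decay; apply: integral_ge0 => v _.
    by rewrite lee_fin mulr_ge0// expR_ge0.
  have /(@cvg_geometric _ (expR t)) : (`|1 - c| < 1)%R by rewrite ger0_norm// ltrBlDr ltrDl.
  move=> /cvgr_lt /(_ 4^-1%R); rewrite invr_gt0 ltr0n => /(_ isT)[N _ HN].
  exists N; apply: (@le_trans _ _ (tsum t N (fun u => (expR u)%:E))).
    apply: le_tilted_sum => //.
    - by apply/measurable_EFinP; exact: measurable_expR.
    - by move=> u; rewrite lee_fin ler0n.
    - move=> u; rewrite lee_fin /alive; case: (lerP 0 u) => u0 /=.
        by rewrite -expR0 ler_expR.
      exact: expR_ge0.
  apply: (le_trans (tilted_sum_expR t N)); rewrite lee_fin mulrC ltW//.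
  exact: (HN N (leqnn N)).
exists N.
have h1 : 1 <= \sum_(n < N) tsum t n exit_fun + tsum t N (fun u => (alive u)%:E).
  have := @sum_tilted_ge_sub _ _ _ P0 tau X _ _ P taus Xs copies lam eta t exit_fun
    (fun u => (alive u)%:E) N measurable_exit_fun mal _ _ alive_subsolution.
  rewrite {2}/alive t0; apply=> u; last by rewrite lee_fin ler0n.
  by apply: integral_ge0 => v _; rewrite lee_fin mulr_ge0// ler0n.
pose k (y : R * R) := (tilt lam eta y.1 y.2 * (b < y.1)%R%:R)%R.
have mk : measurable_fun setT k.
  apply: measurable_funM; first exact: measurable_tilt.
  apply: measurable_natr_bool.
  by apply: measurable_fun_ltr => //; exact: measurable_cst.
have k0 y : (0 <= k y)%R by rewrite mulr_ge0 ?tilt_ge0// ler0n.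
have h2 := le_trans (sum_crossings_le t N mk k0) Hbad.
pose gb u := \int[P0]_v (k (tau v, X v) * window (tau v) u)%:E.
have me : measurable_fun setT
    (fun z : (R * R) * R => (k z.1 * window z.1.1 z.2)%:E).
  apply/measurable_EFinP; apply: measurable_funM; last exact: measurable_window_pair.
  exact: (measurableT_comp mk).
have e0 (y : R * R) u : 0 <= (k y * window y.1 u)%:E.
  by rewrite lee_fin mulr_ge0// ler0n.
have mgb : measurable_fun setT gb.
  apply: (@measurable_fun_fubini_tonelli_F _ _ _ _ _ P0
    (fun z : R * Omega0 => (k (tau z.2, X z.2) * window (tau z.2) z.1)%:E)).
    exact: (measurableT_comp me (measurable_fun_pair (measurable_fun_pair
      (measurableT_comp (measurable_funPT tau) measurable_snd)
      (measurableT_comp (measurable_funPT X) measurable_snd)) measurable_fst)).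
  by move=> z; exact: e0.
have gb0 u : 0 <= gb u by apply: integral_ge0 => v _; exact: e0.
have {h2}h2 : \sum_(n < N) tsum t n gb <= (4^-1)%:E.
  move: h2; congr (_ <= _); apply: eq_bigr => n _.
  exact: (integral_next_pair copies lam eta t n me e0).
have mwin u : measurable_fun setT (fun v => window (tau v) u).
  apply: measurable_natr_bool; apply: measurable_and; first exact: measurable_cst.
  by apply: measurable_fun_ltr => //; exact: measurable_cst.
have h3 u : exit_fun u <= (window b u)%:E + gb u.
  case: (ltP u 0%R) => u0.
    have -> : exit_fun u = 0.
      by apply: integral0_eq => v _; rewrite /window leNgt u0 mulr0.
    by apply: (adde_ge0 _ (gb0 u)); rewrite lee_fin ler0n.
  case: (ltP u b) => ub.
    rewrite {1}/window u0 ub /=; apply: le_trans (leeDl _ (gb0 u)).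
    rewrite -(integral_tilt_cst ler01); apply: ge0_le_integral => //.
    - by move=> v _; rewrite lee_fin mulr_ge0// ler0n.
    - by apply/measurable_EFinP; apply: measurable_funM.
    - by apply/measurable_EFinP; apply: measurable_funM.
    - by move=> v _; rewrite lee_fin ler_wpM2l// /window; case: (_ && _).
  rewrite -[leLHS]add0e; apply: leeD; first by rewrite lee_fin ler0n.
  apply: ge0_le_integral => //.
  - by move=> v _; rewrite lee_fin mulr_ge0// ler0n.
  - by apply/measurable_EFinP; apply: measurable_funM.
  - exact: (measurableT_comp me (measurable_fun_pair (measurable_fun_pair
      (measurable_funPT tau) (measurable_funPT X)) (measurable_cst u))).
  - move=> v _; rewrite lee_fin -mulrA ler_wpM2l// /window u0/=.
    by case: (ltP u (tau v)) => uv; rewrite ?mulr0// (le_lt_trans ub uv) mulr1.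
have {}h3 : \sum_(n < N) tsum t n exit_fun <=
    \sum_(n < N) tsum t n (fun u => (window b u)%:E) + (4^-1)%:E.
  apply: le_trans (leeD2l _ h2); rewrite -big_split/=.
  apply: lee_sum => n _; rewrite -tilted_sumD//; last first.
    by move=> u; rewrite lee_fin ler0n.
  apply: le_tilted_sum => //.
    by apply: emeasurable_funD.
  by move=> u; apply: integral_ge0 => v _; rewrite lee_fin mulr_ge0// ler0n.
have h4 : (2^-1)%:E <= \sum_(n < N) tsum t n (fun u => (window b u)%:E).
  have := le_trans h1 (leeD h3 HN).
  case: (\sum_(n < N) tsum t n (fun u => (window b u)%:E)) => [r| |]//.
    by rewrite -!EFinD !lee_fin; lra.
  by move=> _; rewrite leey.
have {}h4 : (p / 2)%:E <= p%:E * \sum_(n < N) tsum t n (fun u => (window b u)%:E).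
  by rewrite EFinM; apply: lee_wpmul2l.
apply: (le_trans h4); rewrite ge0_sume_distrr//; last first.
  by move=> n _; apply: tilted_sum_ge0 => u; rewrite lee_fin ler0n.
have me' : measurable_fun setT
    (fun z : (R * R) * R => (window b z.2 * (z.2 < z.1.1)%R%:R)%:E).
  apply/measurable_EFinP; apply: measurable_funM.
    exact: (measurableT_comp (measurable_window b)).
  apply: measurable_natr_bool; apply: measurable_fun_ltr => //.
  exact: measurableT_comp.
have e0' (y : R * R) u : 0 <= (window b u * (u < y.1)%R%:R)%:E.
  by rewrite lee_fin mulr_ge0// ler0n.
apply: lee_sum => n _; rewrite -tilted_sumZ//; last first.
  by move=> u; rewrite lee_fin ler0n.
rewrite (integral_next_pair copies lam eta t n me' e0').
apply: le_tilted_sum.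
- by apply: emeasurable_funM => //; exact: measurable_cst.
- apply: (@measurable_fun_fubini_tonelli_F _ _ _ _ _ P0
    (fun z : R * Omega0 => (window b z.1 * (z.1 < tau z.2)%R%:R)%:E)).
    exact: (measurableT_comp me' (measurable_fun_pair (measurable_fun_pair
      (measurableT_comp (measurable_funPT tau) measurable_snd)
      (measurableT_comp (measurable_funPT X) measurable_snd)) measurable_fst)).
  by move=> z; exact: (e0' (tau z.2, X z.2)).
- by move=> u; rewrite -EFinM lee_fin mulr_ge0// ler0n.
- move=> u /=.
  have mlt : measurable_fun setT (fun v => (u < tau v)%R%:R : R).
    by apply: measurable_natr_bool; exact: measurable_fun_ltr.
  under eq_integral do rewrite EFinM.
  rewrite ge0_integralZl//; last 2 first.
  + exact/measurable_EFinP.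
  + by rewrite lee_fin ler0n.
  have mset : measurable [set v | (u < tau v)%R].
    apply: (measurable_bool_set (b := fun v : Omega0 => (u < tau v)%R)).
    exact: measurable_fun_ltr.
  have -> : \int[P0]_v ((u < tau v)%R%:R)%:E = P0 [set v | (u < tau v)%R].
    rewrite -[X in P0 X]setIT -integral_indic//; apply: eq_integral => v _.
    rewrite indicE; case: (boolP (u < tau v)%R) => uv; first by rewrite mem_set.
    by rewrite memNset//; exact/negP.
  rewrite {1 2}/window.
  have [u0b|] := boolP (0 <= u < b)%R; last by rewrite mule0 mul0e.
  by rewrite mule1 mul1e; exact: Hp.
Qed.

End occupation.

(** * Second-order remainder of the exponential *)

Section exp_remainder.
Context {R : realType}.
Implicit Types x y : R.

Lemma nondecreasing_of_derive_ge0 (f f' : R -> R) :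
  (forall x, is_derive x (1 : R) f (f' x)) -> (forall x, 0 <= f' x) ->
  forall x y, x <= y -> f x <= f y.
Proof.
move=> df f'0 x y xy.
apply: (@ger0_derive1_ndecr _ f x y) => //.
- by move=> z _; rewrite derive1E derive_val.
- apply: derivable_within_continuous => z _; exact: ex_derive.
Qed.

Lemma expR_taylor2_ndecr x y : x <= y ->
  expR x - 1 - x - x ^+ 2 / 2 <= expR y - 1 - y - y ^+ 2 / 2.
Proof.
apply: (@nondecreasing_of_derive_ge0
  (fun x => expR x - 1 - x - x ^+ 2 / 2) (fun x => expR x - 1 - x)).
  move=> z; apply: is_derive_eq.
  rewrite /GRing.scale/= ?expr1 ?subr0 ?mulr1; lra.
by move=> z; have := expR_ge1Dx z; lra.
Qed.

(** The derivative is x (1 - exp (- x)), which is never negative; this gives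
    the half of the remainder bounds that carries the factor exp y. *)
Lemma expRN_taylor2_ndecr x y : x <= y ->
  x ^+ 2 / 2 + (1 + x) * expR (- x) <= y ^+ 2 / 2 + (1 + y) * expR (- y).
Proof.
apply: (@nondecreasing_of_derive_ge0
  (fun x => x ^+ 2 / 2 + (1 + x) * expR (- x)) (fun x => x * (1 - expR (- x)))).
  move=> z; apply: is_derive_eq.
  rewrite /GRing.scale/= ?expr1 ?subr0 ?mulr1; lra.
move=> z; case: (lerP 0 z) => z0.
  by apply: mulr_ge0 => //; rewrite subr_ge0 expR_le1 oppr_le0.
rewrite -mulrNN; apply: mulr_ge0; first by rewrite oppr_ge0 ltW.
by rewrite opprB subr_ge0 -expR0 ler_expR oppr_ge0 ltW.
Qed.

Lemma expR_remainder_bounds y :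
  y ^+ 2 / 2 * expR (- `|y|) <= expR y - 1 - y <= y ^+ 2 / 2 * expR `|y|.
Proof.
have expNK : expR (- y) * expR y = 1 by rewrite -expRD addNr expR0.
have sq0 : 0 <= y ^+ 2 / 2 by rewrite divr_ge0// sqr_ge0.
have e0 := expR_gt0 y.
case: (lerP 0 y) => y0.
- have := expR_taylor2_ndecr y0; have := expRN_taylor2_ndecr y0.
  rewrite ger0_norm// !oppr0 expR0 expr0n/= mul0r => h1 h2.
  have e1 : expR (- y) <= 1 by rewrite expR_le1 oppr_le0.
  apply/andP; split; nra.
- have := expR_taylor2_ndecr (ltW y0); have := expRN_taylor2_ndecr (ltW y0).
  rewrite ltr0_norm// !oppr0 opprK expR0 expr0n/= mul0r => h1 h2.
  have e1 : 1 <= expR (- y) by rewrite -expR0 ler_expR oppr_ge0 ltW.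
  apply/andP; split; nra.
Qed.

(** The function q of the expansion exp y = 1 + y + y ^ 2 q(y), extended to 0
    by continuity. *)
Definition exp_quot y : R := if y == 0 then 2^-1 else (expR y - 1 - y) / y ^+ 2.

Lemma exp_quotE y : expR y = 1 + y + y ^+ 2 * exp_quot y.
Proof.
rewrite /exp_quot; case: eqVneq => [->|y0].
  by rewrite expR0 expr0n/= mul0r !addr0.
by rewrite mulrC mulfVK ?sqrf_eq0//; ring.
Qed.

Lemma exp_quot_bounds y : 2^-1 * expR (- `|y|) <= exp_quot y <= 2^-1 * expR `|y|.
Proof.
have [->|y0] := eqVneq y 0.
  by rewrite /exp_quot eqxx normr0 oppr0 expR0 mulr1 lexx.
have /andP[] := expR_remainder_bounds y; rewrite /exp_quot (negbTE y0).
have sq0 : 0 < y ^+ 2 by rewrite exprn_even_gt0.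
by move=> h1 h2; rewrite ler_pdivlMr// ler_pdivrMr//; apply/andP; split; nra.
Qed.

Lemma exp_quot_ge0 y : 0 <= exp_quot y.
Proof.
have /andP[+ _] := exp_quot_bounds y; apply: le_trans.
by rewrite mulr_ge0// expR_ge0.
Qed.

Lemma continuous_exp_quot : continuous exp_quot.
Proof.
move=> y; have [->|y0] := eqVneq y 0.
  rewrite /continuous_at /exp_quot eqxx.
  apply: (@squeeze_cvgr _ _ _ _ (fun y => 2^-1 * expR (- `|y|))
     (fun y => 2^-1 * expR `|y|)).
  - by near=> z; exact: exp_quot_bounds.
  - rewrite [X in _ --> X](_ : _ = 2^-1 * expR (- `|0 : R|)); last first.
      by rewrite normr0 oppr0 expR0 mulr1.
    have : {for 0, continuous (fun y : R => 2^-1 * expR (- `|y|))}.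
      apply: continuousM; first exact: cst_continuous.
      apply: continuous_comp; last exact: continuous_expR.
      apply: continuousN; exact: norm_continuous.
    exact.
  - rewrite [X in _ --> X](_ : _ = 2^-1 * expR `|0 : R|); last by rewrite normr0 expR0 mulr1.
    have : {for 0, continuous (fun y : R => 2^-1 * expR `|y|)}.
      apply: continuousM; first exact: cst_continuous.
      apply: continuous_comp; last exact: continuous_expR.
      exact: norm_continuous.
    exact.
have e : \forall z \near y, (expR z - 1 - z) / z ^+ 2 = exp_quot z.
  near=> z; rewrite /exp_quot ifF//; apply/negbTE; near: z.
  exact: (cvgr_neq0 y cvg_id).
apply: cvg_trans; first exact: near_eq_cvg e.
rewrite (_ : exp_quot y = (expR y - 1 - y) / y ^+ 2); last first.
  by rewrite /exp_quot (negbTE y0).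
apply: cvgM.
  by apply: cvgB; [apply: cvgB; [exact: continuous_expR|exact: cvg_cst]|exact: cvg_id].
by apply: cvgV; [rewrite sqrf_eq0|exact: exprn_continuous].
Unshelve. all: by end_near. Qed.

End exp_remainder.

Section domination.
Context {R : realType}.
Implicit Types a C eps l x s y : R.

Lemma le_expR x : x <= expR x.
Proof. by have := expR_ge1Dx x; lra. Qed.

(** If s >= eps x ^ 2 / 2, the exponent is at most z - (a eps / 2) z ^ 2 with
    z = |l x|, which is bounded. If s < eps x ^ 2 / 2, then |l x| <= eps x ^ 2
    / 4 + C ^ 2 / eps, and both the prefactor and the exponential are
    controlled by exp (eps x ^ 2 / 4), whose square is at most exp (eps x ^ 2
    - s). *)
Lemma tilt_domination eps a C : 0 < eps -> 0 < a -> 0 <= C ->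
  exists2 K : R, 0 <= K & forall l x s, `|l| <= C -> 0 < s ->
    (1 + s + x ^+ 2) * expR (`|l * x| - a * l ^+ 2 * s) <=
    K * (1 + x ^+ 2 + s + expR (eps * x ^+ 2 - s)).
Proof.
move=> eps0 a0 C0.
pose K1 : R := expR (2 * a * eps)^-1; pose K2 : R := (3 + 4 / eps) * expR (C ^+ 2 / eps).
have K10 : 0 <= K1 by exact: expR_ge0.
have K20 : 0 <= K2.
  by rewrite mulr_ge0 ?expR_ge0// addr_ge0// divr_ge0// ltW.
exists (K1 + K2); first exact: addr_ge0.
move=> l x s lC s0.
have x2 : 0 <= x ^+ 2 by exact: sqr_ge0.
have E0 : 0 <= expR (eps * x ^+ 2 - s) by exact: expR_ge0.
have S0 : 0 <= 1 + s + x ^+ 2 by rewrite !addr_ge0// ltW.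
have [sx|sx] := lerP (eps * x ^+ 2 / 2) s.
- have e1 : expR (`|l * x| - a * l ^+ 2 * s) <= K1.
    rewrite ler_expR.
    have h1 : a * l ^+ 2 * (eps * x ^+ 2 / 2) <= a * l ^+ 2 * s.
      by rewrite ler_wpM2l// mulr_ge0 ?sqr_ge0// ltW.
    apply: (@le_trans _ _ (`|l * x| - a * l ^+ 2 * (eps * x ^+ 2 / 2))).
      by rewrite lerB.
    have -> : a * l ^+ 2 * (eps * x ^+ 2 / 2) = a * eps / 2 * `|l * x| ^+ 2.
      by rewrite real_normK ?num_real//; field.
    move: `|l * x| => z; set k := a * eps.
    have k0 : 0 < k by exact: mulr_gt0.
    (* Completing the square in z = |l x|. *)
    have -> : (2 * a * eps)^-1 = z - k / 2 * z ^+ 2 + (k * z - 1) ^+ 2 / (2 * k).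
      by rewrite /k; field; rewrite !gt_eqF.
    by rewrite lerDl divr_ge0 ?sqr_ge0// mulr_ge0// ltW.
  apply: (@le_trans _ _ (K1 * (1 + s + x ^+ 2))).
    by rewrite mulrC ler_wpM2r.
  apply: ler_pM => //; first by rewrite lerDl.
  by lra.
- have h1 : `|l * x| <= eps * x ^+ 2 / 4 + C ^+ 2 / eps.
    apply: (@le_trans _ _ (C * `|x|)); first by rewrite normrM ler_wpM2r.
    rewrite -subr_ge0 -[x ^+ 2]real_normK ?num_real//.
    have -> : eps * `|x| ^+ 2 / 4 + C ^+ 2 / eps - C * `|x| =
       (eps * `|x| / 2 - C) ^+ 2 / eps by field; rewrite gt_eqF.
    by rewrite divr_ge0 ?sqr_ge0// ltW.
  have h2 : expR (`|l * x| - a * l ^+ 2 * s) <=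
      expR (C ^+ 2 / eps) * expR (eps * x ^+ 2 / 4).
    rewrite -expRD ler_expR.
    have : 0 <= a * l ^+ 2 * s.
      by rewrite mulr_ge0 ?(ltW s0)// mulr_ge0 ?sqr_ge0// ltW.
    by move: h1; lra.
  have h3 : 1 + s + x ^+ 2 <= (3 + 4 / eps) * expR (eps * x ^+ 2 / 4).
    have e1 : 1 <= expR (eps * x ^+ 2 / 4).
      by rewrite -expR0 ler_expR divr_ge0// mulr_ge0// ltW.
    move: e1 (le_expR (eps * x ^+ 2 / 4)).
    set E := expR _ => e1 h.
    have -> : (3 + 4 / eps) * E = E + 2 * E + 4 / eps * E by ring.
    have h' : x ^+ 2 <= 4 / eps * E.
      rewrite mulrAC ler_pdivlMr//; lra.
    lra.
  have h4 : expR (eps * x ^+ 2 / 4) * expR (eps * x ^+ 2 / 4) <=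
      expR (eps * x ^+ 2 - s) by rewrite -expRD ler_expR; lra.
  apply: (@le_trans _ _ (K2 * expR (eps * x ^+ 2 - s))); last first.
    by apply: ler_pM => //; [rewrite lerDr|rewrite lerDr; lra].
  apply: (le_trans (ler_pM S0 (expR_ge0 _) h3 h2)).
  rewrite /K2.
  have -> : (3 + 4 / eps) * expR (eps * x ^+ 2 / 4) *
      (expR (C ^+ 2 / eps) * expR (eps * x ^+ 2 / 4)) =
      (3 + 4 / eps) * expR (C ^+ 2 / eps) *
      (expR (eps * x ^+ 2 / 4) * expR (eps * x ^+ 2 / 4)) by ring.
  by rewrite ler_wpM2l.
Qed.

Lemma expR_remainder_le0 y : y <= 0 -> expR y - 1 - y <= y ^+ 2 / 2.
Proof.
move=> y0; have := expR_taylor2_ndecr y0.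
by rewrite expR0 expr0n/= mul0r; lra.
Qed.

(** The left-hand side is (exp y - 1 - y) / l ^ 2 with y = l x - a l ^ 2 s.
    The bound must be linear in s, since s ^ 2 need not be integrable: for y
    <= 0 it comes from exp y <= exp (l x) or exp y <= 1, and for y > 0 from y
    <= l x. *)
Lemma exp_quot_domination a l x s : 0 < a -> 0 < s ->
  (x - a * l * s) ^+ 2 * exp_quot (l * x - a * l ^+ 2 * s) <=
  x ^+ 2 + a * s + x ^+ 2 * expR (`|l * x| - a * l ^+ 2 * s).
Proof.
move=> a0 s0.
have x2 : 0 <= x ^+ 2 by exact: sqr_ge0.
have as0 : 0 < a * s by exact: mulr_gt0.
have E0 := expR_ge0 (`|l * x| - a * l ^+ 2 * s).
have xE0 := mulr_ge0 x2 E0.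
have [->|l0] := eqVneq l 0.
  rewrite !mulr0 !mul0r expr0n/= mulr0 mul0r subr0 normr0 subrr expR0 mulr1.
  rewrite /exp_quot eqxx; lra.
have l2 : 0 < l ^+ 2 by rewrite exprn_even_gt0.
set y := l * x - a * l ^+ 2 * s.
have -> : (x - a * l * s) ^+ 2 * exp_quot y = (expR y - 1 - y) / l ^+ 2.
  have := exp_quotE y => ->; rewrite /y; field; exact: l0.
rewrite ler_pdivrMr//.
set r := a * l ^+ 2 * s.
have r0 : 0 < r by rewrite /r mulr_gt0// mulr_gt0.
have yE : y = l * x - r by [].
have [y0|y0] := lerP y 0.
- have h : expR y - 1 - y <= (l * x) ^+ 2 / 2 + r.
    have [p0|p0] := lerP (l * x) 0.
      have := expR_remainder_le0 p0.
      have : expR y <= expR (l * x) by rewrite ler_expR yE; lra.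
      rewrite yE; lra.
    have : expR y <= 1 by rewrite expR_le1.
    have := sqr_ge0 (l * x); rewrite yE; lra.
  apply: (le_trans h); rewrite exprMn /r.
  have := mulr_ge0 (ltW l2) x2; have := mulr_ge0 (ltW l2) xE0; lra.
- have /andP[_] := expR_remainder_bounds y; rewrite gtr0_norm// => h.
  have p0 : 0 < l * x by rewrite yE in y0; lra.
  apply: (le_trans h); rewrite gtr0_norm//.
  have -> : l * x - a * l ^+ 2 * s = y by [].
  have ey := expR_gt0 y.
  have yp : y ^+ 2 <= (l * x) ^+ 2 by rewrite ler_pXn2r ?nnegrE// ?(ltW y0)// ?(ltW p0)// yE; lra.
  move: yp; rewrite exprMn => yp.
  have h1 : y ^+ 2 / 2 * expR y <= l ^+ 2 * x ^+ 2 / 2 * expR y.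
    by rewrite ler_wpM2r ?expR_ge0//; lra.
  apply: (le_trans h1).
  have := mulr_ge0 (ltW l2) (mulr_ge0 x2 (ltW ey)).
  have := mulr_ge0 (ltW l2) x2; have := mulr_ge0 (ltW l2) (ltW as0); nra.
Qed.

(** The tangent to exp at t y lies below exp at the points y and 0; these two
    inequalities are averaged with weights t and 1 - t. *)
Lemma expR_convex0 t y : 0 <= t <= 1 -> expR (t * y) <= t * expR y + (1 - t).
Proof.
move=> /andP[t0 t1].
have h1 := expR_ge1Dx ((1 - t) * y); have h2 := expR_ge1Dx (- (t * y)).
have e0 := expR_gt0 (t * y).
have E1 : expR y = expR (t * y) * expR ((1 - t) * y) by rewrite -expRD; congr expR; ring.
have E2 : 1 = expR (t * y) * expR (- (t * y)) by rewrite -expRD subrr expR0.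
have g1 : expR (t * y) * (1 + (1 - t) * y) <= expR y by rewrite E1 ler_wpM2l// ltW.
have g2 : expR (t * y) * (1 - t * y) <= 1 by rewrite [leRHS]E2 ler_wpM2l// ltW.
have g3 := ler_wpM2l t0 g1.
have t1' : 0 <= 1 - t by rewrite subr_ge0.
have := ler_wpM2l t1' g2; lra.
Qed.

End domination.

(** * The normalizing exponent *)

Section mgf.
Context (R : realType) d0 (Omega0 : measurableType d0) (P0 : probability Omega0 R)
  (tau X : {RV P0 >-> R}) (eps : R).
Hypothesis tau_gt0 : {ae P0, forall w, 0 < tau w}.
Hypothesis eps_gt0 : 0 < eps.
Hypothesis exp_moment : (\int[P0]_w (expR (eps * X w ^+ 2 - tau w))%:E < +oo)%E.
Hypothesis EX : (\int[P0]_w (X w)%:E = 0)%E.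
Hypothesis EX2 : (\int[P0]_w (X w ^+ 2)%:E = 1)%E.
Hypothesis Etau : (\int[P0]_w (tau w)%:E = 1)%E.

Let mX : measurable_fun setT X. Proof. exact: measurable_funPT. Qed.
Let mtau : measurable_fun setT tau. Proof. exact: measurable_funPT. Qed.

Let mX2 : measurable_fun setT (fun w => X w ^+ 2).
Proof. exact: measurable_funX. Qed.

Lemma integrable_ge0 (f : Omega0 -> R) : measurable_fun setT f ->
  (forall w, 0 <= f w) -> (\int[P0]_w (f w)%:E < +oo)%E ->
  P0.-integrable setT (EFin \o f).
Proof.
move=> mf f0 fi; apply/integrableP; split; first exact/measurable_EFinP.
by under eq_integral do rewrite /= ger0_norm//.
Qed.

Lemma integrable_X2 : P0.-integrable setT (EFin \o (fun w => X w ^+ 2)).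
Proof.
by apply: integrable_ge0 => // [w|]; [exact: sqr_ge0|rewrite EX2 ltry].
Qed.

Lemma integrable_const (k : R) : P0.-integrable setT (EFin \o (fun=> k)).
Proof. exact: (finite_measure_integrable_cst P0 k (A := setT)). Qed.

Lemma integrable_tau : P0.-integrable setT (EFin \o tau).
Proof.
apply/integrableP; split; first exact/measurable_EFinP.
have -> : (\int[P0]_w `|(EFin \o tau) w| = \int[P0]_w (tau w)%:E)%E.
  2: by rewrite Etau ltry.
apply: ae_eq_integral => //.
- by apply: measurableT_comp => //; exact/measurable_EFinP.
- exact/measurable_EFinP.
- by apply: filterS tau_gt0 => w t0 _ /=; rewrite gtr0_norm.
Qed.

Lemma Rintegral_const (k : R) : \int[P0]_w k = k.
Proof. by rewrite /Rintegral integral_probability_cst. Qed.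

(** The integrable majorant of all the functions met below. *)
Definition envelope w := 1 + X w ^+ 2 + tau w + expR (eps * X w ^+ 2 - tau w).

Lemma integrable_envelope : P0.-integrable setT (EFin \o envelope).
Proof.
have ie : P0.-integrable setT (EFin \o (fun w => expR (eps * X w ^+ 2 - tau w))).
  apply: integrable_ge0 => //; apply: measurableT_comp; first exact: measurable_expR.
  by apply: measurable_funB => //; exact: measurable_funM.
exact: (integrableD measurableT (integrableD measurableT (integrableD measurableT
  (integrable_const 1) integrable_X2) integrable_tau) ie).
Qed.

Lemma integrable_X : P0.-integrable setT (EFin \o X).
Proof.
apply: (integrable_ae_le (g := fun w => 1 + X w ^+ 2)) => //.
  exact: (integrableD measurableT (integrable_const 1) integrable_X2).
apply: aeW => w; have := sqr_ge0 (1 - `|X w|); rewrite sqrrB real_normK ?num_real//.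
have := normr_ge0 (X w); nra.
Qed.

Definition mgf (l e : R) : R := \int[P0]_w tilt l e (tau w) (X w).

Let mtilt l e : measurable_fun setT (fun w => tilt l e (tau w) (X w)).
Proof. exact: measurable_tilt. Qed.

Lemma tilt_envelope a C : 0 < a -> 0 <= C -> exists2 K : R, 0 <= K &
  forall l e, `|l| <= C -> a * l ^+ 2 <= e ->
  {ae P0, forall w, (1 + `|tau w|) * tilt l e (tau w) (X w) <= K * envelope w}.
Proof.
move=> a0 C0; have [K K0 HK] := tilt_domination eps_gt0 a0 C0.
exists K => // l e lC ale; apply: filterS tau_gt0 => w t0.
rewrite gtr0_norm//; apply: le_trans (HK l (X w) (tau w) lC t0).
apply: ler_pM; rewrite ?expR_ge0//; first by rewrite addr_ge0// ltW.
  by rewrite lerDl sqr_ge0.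
rewrite ler_expR; apply: lerB; first exact: ler_norm.
by rewrite ler_wpM2r// ltW.
Qed.

Lemma integrable_tilt_tau a l e : 0 < a -> a * l ^+ 2 <= e ->
  P0.-integrable setT
    (EFin \o (fun w => (1 + `|tau w|) * tilt l e (tau w) (X w))).
Proof.
move=> a0 ale; have [K K0 HK] := tilt_envelope a0 (normr_ge0 l).
apply: (integrable_ae_le (g := fun w => K * envelope w)).
- apply: measurable_funM => //; apply: measurable_funD; first exact: measurable_cst.
  exact: measurableT_comp.
- exact: (integrableZl measurableT K integrable_envelope).
- apply: filterS (HK l e (lexx _) ale) => w.
  by rewrite [X in _ -> X <= _]ger0_norm// mulr_ge0 ?tilt_ge0// addr_ge0.
Qed.

Lemma integrable_tilt l e : 0 < e ->
  P0.-integrable setT (EFin \o (fun w => tilt l e (tau w) (X w))).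
Proof.
move=> e0; have a0 : 0 < e / (l ^+ 2 + 1) by rewrite divr_gt0// ltr_wpDl// sqr_ge0.
have ale : e / (l ^+ 2 + 1) * l ^+ 2 <= e.
  rewrite mulrAC ler_pdivrMr ?ltr_wpDl ?sqr_ge0//.
  by rewrite ler_pM2l// lerDl.
apply: (integrable_ae_le _ (integrable_tilt_tau a0 ale)) => //.
apply: aeW => w; rewrite ger0_norm ?tilt_ge0//.
by rewrite ler_peMl ?tilt_ge0// lerDl.
Qed.

Lemma mgf_lt l e1 e2 : e1 < e2 ->
  P0.-integrable setT (EFin \o (fun w => tilt l e1 (tau w) (X w))) ->
  mgf l e2 < mgf l e1.
Proof.
move=> e12 i1.
have h : {ae P0, forall w, tilt l e2 (tau w) (X w) < tilt l e1 (tau w) (X w)}.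
  apply: filterS tau_gt0 => w t0; rewrite ltr_expR ltrD2l ltrN2.
  by rewrite ltr_pM2r.
have i2 : P0.-integrable setT (EFin \o (fun w => tilt l e2 (tau w) (X w))).
  apply: (integrable_ae_le _ i1) => //; apply: filterS h => w /ltW.
  by rewrite ger0_norm// tilt_ge0.
rewrite -subr_gt0 /mgf -RintegralB//; apply: Rintegral_gt0.
  exact: (integrableB measurableT i1 i2).
by apply: filterS h => w; rewrite subr_gt0.
Qed.

Lemma mgf_continuous l e1 e2 : 0 < e1 -> {in `]e1, e2[, continuous (mgf l)}.
Proof.
move=> e10 x xe.
apply: (@continuity_under_integral _ _ _ P0 (fun e w => tilt l e (tau w) (X w))
  setT measurableT e1 e2 _ _ _ (integrable_tilt l e10)).
- by move=> y; rewrite /= in_itv/= => /andP[e1y _]; apply: integrable_tilt; lra.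
- apply: aeW => w _ y _; rewrite /tilt.
  apply: continuous_comp; last exact: continuous_expR.
  apply: continuousB; first exact: cst_continuous.
  apply: continuousM; [exact: cvg_id|exact: cst_continuous].
- move=> y; rewrite /= in_itv/= => /andP[e1y _].
  apply: filterS tau_gt0 => w t0 _; rewrite ger0_norm ?tilt_ge0//.
  by rewrite ler_expR lerD2l lerN2 ler_pM2r// ltW.
- by rewrite inE.
Qed.

Lemma mgf_convex l e t : 0 <= t <= 1 -> 0 <= t * e ->
  P0.-integrable setT (EFin \o (fun w => tilt l e (tau w) (X w))) ->
  P0.-integrable setT (EFin \o (fun w => tilt (t * l) (t * e) (tau w) (X w))) /\
  mgf (t * l) (t * e) <= t * mgf l e + (1 - t).
Proof.
move=> t01 te i1; have /andP[t0 t1] := t01.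
have h w : tilt (t * l) (t * e) (tau w) (X w) <= t * tilt l e (tau w) (X w) + (1 - t).
  rewrite /tilt; apply: le_trans (expR_convex0 _ t01).
  by rewrite mulrBr !mulrA.
have i3 : P0.-integrable setT (EFin \o (fun w => t * tilt l e (tau w) (X w) + (1 - t))).
  exact: (integrableD measurableT (integrableZl measurableT t i1) (integrable_const (1 - t))).
have i2 : P0.-integrable setT (EFin \o (fun w => tilt (t * l) (t * e) (tau w) (X w))).
  apply: (integrable_ae_le _ i3) => //; apply: aeW => w.
  by rewrite ger0_norm ?tilt_ge0.
split=> //; apply: (le_trans (ae_le_Rintegral i2 i3 (aeW _ h))).
rewrite RintegralD//; last 2 first.
- exact: (integrableZl measurableT t i1).
- exact: integrable_const.
by rewrite RintegralZl// Rintegral_const.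
Qed.

(** This is (exp y - 1 - y) / l ^ 2 with y = l X - a l ^ 2 tau, in a form that
    is defined and continuous at l = 0. *)
Definition second_order a l w : R :=
  (X w - a * l * tau w) ^+ 2 * exp_quot (l * X w - a * l ^+ 2 * tau w).

Let msecond a l : measurable_fun setT (second_order a l).
Proof.
apply: measurable_funM.
  apply: measurable_funX; apply: measurable_funB => //.
  by apply: measurable_funM => //; exact: measurable_cst.
apply: measurableT_comp.
  by apply: continuous_measurable_fun; exact: continuous_exp_quot.
by apply: measurable_funB; apply: measurable_funM => //; exact: measurable_cst.
Qed.

Lemma second_order_ge0 a l w : 0 <= second_order a l w.
Proof. by rewrite mulr_ge0 ?sqr_ge0 ?exp_quot_ge0. Qed.

Lemma second_order_envelope a : 0 < a ->
  exists K : R, forall l, `|l| <= 1 ->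
    {ae P0, forall w, `|second_order a l w| <= K * envelope w}.
Proof.
move=> a0; have [K K0 HK] := tilt_domination eps_gt0 a0 ler01.
exists (1 + a + K) => l l1; apply: filterS tau_gt0 => w t0.
rewrite ger0_norm ?second_order_ge0//.
apply: (le_trans (exp_quot_domination _ _ a0 t0)).
have := HK l (X w) (tau w) l1 t0; set E := expR (`|_| - _) => h.
have E0 : 0 <= E by exact: expR_ge0.
have F0 := expR_ge0 (eps * X w ^+ 2 - tau w).
have X0 := sqr_ge0 (X w).
have V0 : X w ^+ 2 + a * tau w <= (1 + a) * envelope w.
  rewrite /envelope; set F := expR _ in F0 *; set x := X w ^+ 2 in X0 *.
  have := mulr_ge0 (ltW a0) F0; have := mulr_ge0 (ltW a0) X0; nra.
have : X w ^+ 2 * E <= K * envelope w.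
  apply: le_trans h; rewrite ler_wpM2r// lerDr; lra.
by rewrite mulrDl; lra.
Qed.

Lemma integrable_second_order a l : 0 < a -> `|l| <= 1 ->
  P0.-integrable setT (EFin \o second_order a l).
Proof.
move=> a0 l1; have [K HK] := second_order_envelope a0.
apply: (integrable_ae_le (g := fun w => K * envelope w)) => //; last exact: HK.
exact: (integrableZl measurableT K integrable_envelope).
Qed.

Lemma mgf_taylor a l : 0 < a -> `|l| <= 1 ->
  mgf l (a * l ^+ 2) = 1 + l ^+ 2 * (\int[P0]_w second_order a l w - a).
Proof.
move=> a0 l1.
have i2 := integrable_second_order a0 l1.
have iX := integrableZl measurableT l integrable_X.
have it := integrableZl measurableT (a * l ^+ 2) integrable_tau.
have i3 := integrableZl measurableT (l ^+ 2) i2.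
have RX : \int[P0]_w X w = 0 by rewrite /Rintegral EX.
have Rtau : \int[P0]_w tau w = 1 by rewrite /Rintegral Etau.
rewrite /mgf.
under eq_Rintegral => w _.
  rewrite (_ : tilt _ _ _ _ = (1 + (l * X w - a * l ^+ 2 * tau w)) +
     l ^+ 2 * second_order a l w); last first.
    rewrite /tilt exp_quotE /second_order; ring.
  over.
have i1 : P0.-integrable setT (EFin \o (fun w => l * X w - a * l ^+ 2 * tau w)).
  exact: (integrableB measurableT iX it).
have i4 : P0.-integrable setT (EFin \o (fun w => 1 + (l * X w - a * l ^+ 2 * tau w))).
  exact: (integrableD measurableT (integrable_const 1) i1).
rewrite RintegralD// RintegralD//; last exact: integrable_const.
rewrite Rintegral_const RintegralB// RintegralZl//; last exact: integrable_X.
rewrite (@RintegralZl _ _ _ P0 setT tau (a * l ^+ 2) measurableT integrable_tau).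
rewrite RintegralZl// RX Rtau; ring.
Qed.

Lemma second_order_cvg a : 0 < a ->
  (\int[P0]_w second_order a l w) @[l --> (0 : R)] --> (2^-1 : R).
Proof.
move=> a0; have [K HK] := second_order_envelope a0.
have -> : 2^-1 = \int[P0]_w second_order a 0 w.
  under eq_Rintegral => w _.
    rewrite (_ : second_order _ _ _ = 2^-1 * X w ^+ 2); last first.
      by rewrite /second_order expr0n/= !(mulr0, mul0r, subr0) /exp_quot eqxx mulrC.
    over.
  rewrite RintegralZl//; last exact: integrable_X2.
  by rewrite /Rintegral EX2 mulr1.
have cy w : continuous (fun l : R => l * X w - a * l ^+ 2 * tau w).
  move=> l; apply: cvgB.
    by apply: cvgM; [exact: cvg_id|exact: cvg_cst].
  apply: cvgM; last exact: cvg_cst.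
  by apply: cvgM; [exact: cvg_cst|exact: exprn_continuous].
apply: (@continuity_under_integral _ _ _ P0 (second_order a)
  setT measurableT (-1) 1 _ _ (fun w => K * envelope w)).
- move=> l; rewrite /= in_itv/= => /andP[l1 l2]; apply: integrable_second_order => //.
  by rewrite ler_norml; lra.
- apply: aeW => w _ l _; rewrite /second_order.
  apply: (@continuousM _ _ (fun l => (X w - a * l * tau w) ^+ 2)
    (fun l => exp_quot (l * X w - a * l ^+ 2 * tau w))).
    apply: (@continuous_comp _ _ _ (fun l => X w - a * l * tau w) (fun x => x ^+ 2)).
      apply: continuousB; first exact: cst_continuous.
      apply: continuousM; last exact: cst_continuous.
      apply: continuousM; [exact: cst_continuous|exact: cvg_id].
    exact: exprn_continuous.
  exact: (continuous_comp (cy w l) (@continuous_exp_quot R _)).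
- exact: (integrableZl measurableT K integrable_envelope).
- move=> l; rewrite /= in_itv/= => /andP[l1 l2].
  have : `|l| <= 1 by rewrite ler_norml; lra.
  by move=> /HK; apply: filterS => w + _.
- by rewrite inE /= in_itv/=; lra.
Qed.

Lemma mgf_large l : exists2 e, 0 < e & mgf l e < 1.
Proof.
have [] := @dominated_convergence _ _ _ P0 setT measurableT
  (fun n w => (tilt l n.+1%:R (tau w) (X w))%:E) (cst 0%E)
  (fun w => (tilt l 1 (tau w) (X w))%:E).
- by move=> n; apply/measurable_EFinP.
- exact: measurable_cst.
- apply: filterS tau_gt0 => w t0 _; apply: cvg_EFin; first exact: nearW.
  have z1 : `|expR (- tau w)| < 1.
    by rewrite ger0_norm ?expR_ge0// expR_lt1 oppr_lt0.
  have := @cvg_geometric _ (expR (l * X w - tau w)) _ z1.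
  apply: cvg_trans; apply: near_eq_cvg; apply: nearW => n /=.
  rewrite /geometric /tilt -expRM_natl -expRD; congr expR.
  by rewrite -natr1; ring.
- exact: integrable_tilt.
- apply: filterS tau_gt0 => w t0 n _ /=; rewrite lee_fin ger0_norm ?tilt_ge0//.
  by rewrite ler_expR lerD2l lerN2 ler_pM2r// ler1n.
move=> _ _; rewrite integral0 => /fine_cvgP[_].
move=> /cvgr_lt /(_ 1 ltr01)[N _ HN].
by exists N.+1%:R; [rewrite ltr0n|exact: (HN N (leqnn N))].
Qed.

Lemma mgf_near0_gt1 a : 0 < a < 2^-1 -> exists2 dl : R, 0 < dl <= 1 &
  forall l, l != 0 -> `|l| < dl -> 1 < mgf l (a * l ^+ 2).
Proof.
move=> /andP[a0 a2]; have := second_order_cvg a0.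
move=> /cvgr_gt /(_ a a2) /nbhs_ballP [dl /= dl0 H].
exists (Num.min dl 1); first by rewrite lt_min dl0 ltr01 ge_min lexx orbT.
move=> l l0; rewrite lt_min => /andP[ldl l1].
rewrite mgf_taylor ?(ltW l1)// ltrDl mulr_gt0 ?exprn_even_gt0//.
by rewrite subr_gt0; apply: H; rewrite -ball_normE /ball_ /= sub0r normrN.
Qed.

Lemma mgf_near0_lt1 a : 2^-1 < a -> exists2 dl : R, 0 < dl <= 1 &
  forall l, l != 0 -> `|l| < dl -> mgf l (a * l ^+ 2) < 1.
Proof.
move=> a2; have a0 : 0 < a by apply: lt_trans a2; rewrite invr_gt0.
have := second_order_cvg a0.
move=> /cvgr_lt /(_ a a2) /nbhs_ballP [dl /= dl0 H].
exists (Num.min dl 1); first by rewrite lt_min dl0 ltr01 ge_min lexx orbT.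
move=> l l0; rewrite lt_min => /andP[ldl l1].
rewrite mgf_taylor ?(ltW l1)// gtrDl pmulr_rlt0 ?exprn_even_gt0//.
by rewrite subr_lt0; apply: H; rewrite -ball_normE /ball_ /= sub0r normrN.
Qed.

Definition normalizing l e : Prop :=
  [/\ 0 <= e, P0.-integrable setT (EFin \o (fun w => tilt l e (tau w) (X w))) &
      mgf l e = 1].

Lemma normalizingP l e :
  (0 <= e /\ (\int[P0]_w (tilt l e (tau w) (X w))%:E = 1)%E) <-> normalizing l e.
Proof.
split=> [[e0 i1]|[e0 i1 m1]]; split => //.
- by apply: integrable_ge0; [|move=> w; exact: tilt_ge0|rewrite i1 ltry].
- by rewrite /mgf /Rintegral i1.
- by rewrite -[RHS]/(1%:E) -m1 /mgf /Rintegral fineK//; exact: integrable_fin_num.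
Qed.

Lemma normalizing_le l e f : normalizing l e ->
  P0.-integrable setT (EFin \o (fun w => tilt l f (tau w) (X w))) ->
  mgf l f <= 1 -> e <= f.
Proof.
move=> [_ _ m1] fi mf1; rewrite leNgt; apply/negP => fe.
by have := mgf_lt fe fi; rewrite m1 ltNge mf1.
Qed.

Lemma normalizing_ge l e f : normalizing l e -> 1 <= mgf l f -> f <= e.
Proof.
move=> [_ ei m1] mf1; rewrite leNgt; apply/negP => fe.
by have := mgf_lt fe ei; rewrite m1 ltNge mf1.
Qed.

Lemma normalizing_unique l e f : normalizing l e -> normalizing l f -> e = f.
Proof.
move=> he hf; apply/le_anti/andP; split.
  by case: (hf) => _ fi mf; apply: (normalizing_le he fi); rewrite mf.
by case: (he) => _ ei me; apply: (normalizing_le hf ei); rewrite me.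
Qed.

Lemma normalizing0 : normalizing 0 0.
Proof.
have E w : tilt 0 0 (tau w) (X w) = 1 by rewrite /tilt !mul0r subr0 expR0.
split=> //.
  by under eq_fun do rewrite E; exact: integrable_const.
by rewrite /mgf; under eq_Rintegral do rewrite E; exact: Rintegral_const.
Qed.

(** For small l, m(l, l ^ 2 / 4) > 1 by the expansion; an arbitrary l is
    scaled down to a small t l, and convexity along the segment from the
    origin, where m = 1, brings the inequality back to l. *)
Lemma mgf_small l : l != 0 -> exists2 e, 0 < e & 1 < mgf l e.
Proof.
move=> l0.
have [dl /andP[dl0 dl1] H] : exists2 dl : R, 0 < dl <= 1 &
    forall l, l != 0 -> `|l| < dl -> 1 < mgf l (4^-1 * l ^+ 2).
  by apply: mgf_near0_gt1; lra.
have nl0 : 0 < `|l| by rewrite normr_gt0.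
(* This scaling keeps t <= 1 and |t l| < dl at once. *)
pose t := dl / (dl + `|l|).
have s0 : 0 < dl + `|l| by rewrite addr_gt0.
have t0 : 0 < t by rewrite divr_gt0.
have t1 : t <= 1 by rewrite ler_pdivrMr// mul1r lerDl ltW.
pose e := 4^-1 * t * l ^+ 2.
have e0 : 0 < e by rewrite mulr_gt0 ?exprn_even_gt0// mulr_gt0// invr_gt0.
exists e => //.
have tl : t * l != 0 by rewrite mulf_neq0// gt_eqF.
have tdl : `|t * l| < dl.
  rewrite normrM gtr0_norm// /t mulrAC ltr_pdivrMr// ltr_pM2l// ltrDr//.
have := H _ tl tdl.
have -> : 4^-1 * (t * l) ^+ 2 = t * e by rewrite /e; ring.
have t01 : 0 <= t <= 1 by rewrite (ltW t0).
have [_] := mgf_convex t01 (mulr_ge0 (ltW t0) (ltW e0)) (integrable_tilt l e0).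
move=> h1 h2; have {h1 h2}h := lt_le_trans h2 h1.
have : t * 1 < t * mgf l e by lra.
by rewrite ltr_pM2l.
Qed.

Lemma normalizing_exists l : exists e, normalizing l e.
Proof.
have [->|l0] := eqVneq l 0; first by exists 0; exact: normalizing0.
have [e1 e10 m1] := mgf_small l0; have [e2 e20 m2] := mgf_large l.
have e12 : e1 <= e2.
  rewrite leNgt; apply/negP => e21.
  by have := mgf_lt e21 (integrable_tilt l e20); rewrite ltNge (ltW (lt_trans m2 m1)).
have cont : {within `[e1, e2], continuous (mgf l)}.
  apply: continuous_in_subspaceT => x; rewrite inE/= in_itv/= => /andP[x1 x2].
  (* The continuity lemma is about an open interval, hence the margins e1 / 2
     and 1. *)
  have e12' : 0 < e1 / 2 by lra.
  have /(_ x) H := @mgf_continuous l (e1 / 2) (e2 + 1) e12'; apply: H.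
  by rewrite in_itv/=; lra.
have [] := @IVT _ (mgf l) e1 e2 1 e12 cont.
  by rewrite ge_min (ltW m2) orbT le_max (ltW m1).
move=> e; rewrite in_itv/= => /andP[ee1 _] me; exists e.
have e0 : 0 < e by lra.
by split; [exact: ltW|exact: integrable_tilt|].
Qed.

(** The set of all (l, e) with m(l, e) <= 1 is convex and contains the origin. *)
Lemma normalizing_convex l e f t : 0 <= t <= 1 -> normalizing l e ->
  normalizing (t * l) f -> f <= t * e.
Proof.
move=> t01 [e0 ei me] hf; have /andP[t0 t1] := t01.
have [i2 h] := mgf_convex t01 (mulr_ge0 t0 e0) ei.
by apply: (normalizing_le hf i2); apply: (le_trans h); rewrite me mulr1 addrC subrK.
Qed.

Section cumulant.
Variable eta : R -> R.
Hypothesis eta_norm : forall l, normalizing l (eta l).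

Lemma eta_at0 : eta 0 = 0.
Proof. exact: (normalizing_unique (eta_norm 0) normalizing0). Qed.

(** The expansion at (1/2 - r) l ^ 2 and (1/2 + r) l ^ 2 encloses eta_l. *)
Lemma eta_near0 (dt : R) : 0 < dt -> exists2 dl : R, 0 < dl &
  forall l, `|l| < dl -> `|eta l - 2^-1 * l ^+ 2| <= dt * l ^+ 2.
Proof.
move=> dt0; pose r := Num.min dt 4^-1.
have r0 : 0 < r by rewrite lt_min dt0 invr_gt0 ltr0n.
have r4 : r <= 4^-1 by rewrite ge_min lexx orbT.
have rdt : r <= dt by rewrite ge_min lexx.
have [d1 /andP[d10 _] H1] : exists2 dl : R, 0 < dl <= 1 &
  forall l, l != 0 -> `|l| < dl -> 1 < mgf l ((2^-1 - r) * l ^+ 2).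
  by apply: mgf_near0_gt1; lra.
have [d2 /andP[d20 _] H2] : exists2 dl : R, 0 < dl <= 1 &
  forall l, l != 0 -> `|l| < dl -> mgf l ((2^-1 + r) * l ^+ 2) < 1.
  by apply: mgf_near0_lt1; lra.
exists (Num.min d1 d2); first by rewrite lt_min d10.
move=> l; rewrite lt_min => /andP[ld1 ld2].
have [->|l0] := eqVneq l 0; first by rewrite eta_at0 expr0n/= !mulr0 subrr normr0.
have l2 : 0 < l ^+ 2 by rewrite exprn_even_gt0.
have h1 := normalizing_ge (eta_norm l) (ltW (H1 l l0 ld1)).
have p0 : 0 < (2^-1 + r) * l ^+ 2 by rewrite mulr_gt0//; lra.
have h2 := normalizing_le (eta_norm l) (integrable_tilt l p0) (ltW (H2 l l0 ld2)).
rewrite ler_norml; move: h1 h2; have := ler_wpM2r (ltW l2) rdt; lra.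
Qed.

(** Near 0 this is the asymptotics. Further away, convexity makes eta grow at
    least linearly in |l|, and on a bounded set a linear bound implies a
    quadratic one. *)
Lemma eta_quadratic_lower C : 0 < C -> exists2 a : R, 0 < a &
  forall l, `|l| <= C -> a * l ^+ 2 <= eta l.
Proof.
move=> C0; have q0 : 0 < 4^-1 :> R by rewrite invr_gt0 ltr0n.
have [dl dl0 H] := eta_near0 q0.
(* Half of dl, since the asymptotics are stated for |l| < dl but used at |l|
   = dh. *)
pose dh := dl / 2.
have dh0 : 0 < dh by rewrite divr_gt0.
pose a := Num.min 4^-1 (dh / (4 * C)).
have a0 : 0 < a by rewrite lt_min invr_gt0 ltr0n/= divr_gt0// mulr_gt0.
have a4 : a <= 4^-1 by rewrite ge_min lexx.
have aC : a <= dh / (4 * C) by rewrite ge_min lexx orbT.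
have Hl l : `|l| <= dh -> 4^-1 * l ^+ 2 <= eta l.
  move=> ld; have /H : `|l| < dl by apply: (le_lt_trans ld); rewrite /dh; lra.
  by rewrite ler_norml; lra.
exists a => // l lC.
have [ld|ld] := lerP `|l| dh.
  by apply: le_trans (Hl _ ld); rewrite ler_wpM2r// sqr_ge0.
have l0 : 0 < `|l| by apply: lt_trans ld.
pose t := dh / `|l|.
have t0 : 0 < t by rewrite divr_gt0.
have t1 : t <= 1 by rewrite ler_pdivrMr// mul1r ltW.
have t01 : 0 <= t <= 1 by rewrite (ltW t0) t1.
have h := normalizing_convex t01 (eta_norm l) (eta_norm (t * l)).
have tl : `|t * l| = dh by rewrite normrM gtr0_norm// /t mulfVK// gt_eqF.
have tl' : `|t * l| <= dh by rewrite tl.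
have h2 := le_trans (Hl _ tl') h.
have : 4^-1 * (t * l) ^+ 2 = t * (4^-1 * dh * `|l|).
  rewrite -[(t * l) ^+ 2]real_normK ?num_real// tl /t; field.
  by rewrite gt_eqF.
move=> E; move: h2; rewrite E ler_pM2l//; apply: le_trans.
have -> : l ^+ 2 = `|l| * `|l| by rewrite -expr2 real_normK ?num_real.
rewrite mulrA ler_pM2r//.
have := ler_pM (ltW a0) (ltW l0) aC lC.
by congr (_ <= _); field; rewrite gt_eqF.
Qed.

Lemma eta_bounded C : 0 < C -> exists2 B : R, 0 <= B &
  forall l, `|l| <= C -> eta l <= B.
Proof.
move=> C0; have eta_ge0 l : 0 <= eta l by case: (eta_norm l).
exists (eta C + eta (- C)); first exact: addr_ge0.
move=> l lC.
pose t := `|l| / C.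
have t0 : 0 <= t by rewrite divr_ge0// ltW.
have t1 : t <= 1 by rewrite ler_pdivrMr// mul1r.
have t01 : 0 <= t <= 1 by rewrite t0.
have key m : t * m = l -> eta l <= eta m.
  move=> tm; have hl := eta_norm l; rewrite -tm in hl.
  have := normalizing_convex t01 (eta_norm m) hl; rewrite tm => h.
  by apply: (le_trans h); rewrite ler_piMl.
have [l0|l0] := lerP 0 l.
  apply: (@le_trans _ _ (eta C)); last by rewrite lerDl.
  by apply: key; rewrite /t mulfVK ?gt_eqF// ger0_norm.
apply: (@le_trans _ _ (eta (- C))); last by rewrite lerDr.
by apply: key; rewrite /t mulrN mulfVK ?gt_eqF// ltr0_norm// opprK.
Qed.

End cumulant.

(** b is the smallest u >= 0 whose tail probability is at most p; it exists by
    right continuity of the tail. *)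
Lemma tail_threshold (p : R) : 0 < p -> exists2 b : R, 0 <= b &
  (P0 [set v | (b < tau v)%R] <= p%:E)%E /\
  forall u, 0 <= u < b -> (p%:E <= P0 [set v | (u < tau v)%R])%E.
Proof.
move=> p0.
have ccdfE u : P0 [set v | (u < tau v)%R] = ccdf tau u.
  rewrite /ccdf /distribution /pushforward; congr (P0 _).
  by apply/seteqP; split=> v /=; rewrite in_itv/= andbT.
pose S : set R := [set u | 0 <= u /\ (ccdf tau u <= p%:E)%E].
have S0 : S !=set0.
  apply: contrapT => nS.
  have : (p%:E <= 0)%E.
    apply: cvge_ge (cvg_ccdfy0 tau); near=> u.
    rewrite leNgt; apply/negP => up; apply: nS; exists u; split; last exact: ltW.
    by near: u; apply: nbhs_pinfty_ge; exact: num_real.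
  by rewrite lee_fin leNgt p0.
have lbS : lbound S 0 by move=> u [].
have hS : has_inf S by split => //; exists 0.
pose b := inf S.
have b0 : 0 <= b by exact: lb_le_inf.
exists b => //; split.
  have rc : ccdf tau u @[u --> b^'+] --> ccdf tau b by exact: ccdf_right_continuous.
  rewrite ccdfE; apply: (cvge_le _ rc); near=> u.
  have ub : 0 < u - b by rewrite subr_gt0; near: u; exact: nbhs_right_gt.
  have [s [_ sp]] := inf_adherent ub hS.
  rewrite -/b addrC subrK => su.
  exact: le_trans (ccdf_nonincreasing tau (ltW su)) sp.
move=> u /andP[u0 ub]; rewrite ccdfE leNgt; apply/negP => up.
have Su : S u by split=> //; exact: ltW.
by have := ge_inf hS.2 Su; rewrite leNgt ub.
Unshelve. all: by end_near. Qed.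

Section uniform_constants.
Variable eta : R -> R.
Hypothesis eta_norm : forall l, normalizing l (eta l).

Lemma EFin_Rintegral (f : Omega0 -> R) : P0.-integrable setT (EFin \o f) ->
  (\int[P0]_w (f w)%:E = (\int[P0]_w f w)%:E)%E.
Proof. by move=> fi; rewrite /Rintegral fineK//; exact: integrable_fin_num. Qed.

Let mdecay : measurable_fun setT (fun w => expR (- tau w)).
Proof.
by apply: measurableT_comp; [exact: measurable_expR|exact: measurableT_comp].
Qed.

(** exp (- C |X| - B tau) (1 - exp (- tau)) bounds exp (l X - eta_l tau) (1 -
    exp (- tau)) from below, does not depend on l, and has a positive
    expectation. *)
Lemma uniform_decay C : 0 < C -> exists2 c : R, 0 < c &
  forall l, `|l| <= C ->
  (\int[P0]_w (tilt l (eta l) (tau w) (X w) * expR (- tau w))%:E <= (1 - c)%:E)%E.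
Proof.
move=> C0; have [B B0 etaB] := eta_bounded eta_norm C0.
pose g w := expR (- (C * `|X w|) - B * tau w) * (1 - expR (- tau w)).
have mg : measurable_fun setT g.
  apply: measurable_funM.
    apply: measurableT_comp; first exact: measurable_expR.
    apply: measurable_funB; last by apply: measurable_funM => //; exact: measurable_cst.
    apply: measurableT_comp => //; apply: measurable_funM; first exact: measurable_cst.
    exact: measurableT_comp.
  by apply: measurable_funB => //; exact: measurable_cst.
have e1 w : 0 < tau w -> 0 < 1 - expR (- tau w).
  by move=> t0; rewrite subr_gt0 expR_lt1 oppr_lt0.
have gi : P0.-integrable setT (EFin \o g).
  apply: (integrable_ae_le mg (integrable_const 1)).
  apply: filterS tau_gt0 => w t0; rewrite ger0_norm; last first.
    by rewrite mulr_ge0 ?expR_ge0// ltW// e1.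
  have E1 : expR (- (C * `|X w|) - B * tau w) <= 1.
    rewrite expR_le1 -opprD oppr_le0 addr_ge0//.
      by rewrite mulr_ge0// ltW.
    by rewrite mulr_ge0// ltW.
  by apply: mulr_ile1; rewrite ?expR_ge0// ltW// e1.
exists (\int[P0]_w g w).
  apply: Rintegral_gt0 => //; apply: filterS tau_gt0 => w t0.
  by rewrite mulr_gt0 ?expR_gt0// e1.
move=> l lC; have [_ mi m1] := eta_norm l.
have mde : measurable_fun setT
    (fun w => tilt l (eta l) (tau w) (X w) * expR (- tau w)).
  exact: measurable_funM.
have di : P0.-integrable setT
    (EFin \o (fun w => tilt l (eta l) (tau w) (X w) * expR (- tau w))).
  apply: (integrable_ae_le mde mi); apply: filterS tau_gt0 => w t0.
  rewrite ger0_norm; last by rewrite mulr_ge0 ?tilt_ge0 ?expR_ge0.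
  by rewrite ler_piMr ?tilt_ge0// expR_le1 oppr_le0 ltW.
rewrite EFin_Rintegral// lee_fin lerBrDr -lerBrDl.
rewrite -m1 /mgf -RintegralB//.
apply: ae_le_Rintegral => //; first exact: (integrableB measurableT mi di).
apply: filterS tau_gt0 => w t0 /=.
rewrite -[X in _ <= X - _]mulr1 -mulrBr; apply: ler_wpM2r; first by rewrite ltW// e1.
rewrite ler_expR; apply: lerB.
  rewrite lerNl; apply: (@le_trans _ _ `|l * X w|).
    by rewrite -normrN ler_norm.
  by rewrite normrM ler_wpM2r.
by rewrite ler_wpM2r ?etaB// ltW.
Qed.

(** The functions have a common integrable majorant, so their integrals are
    small on every event of probability less than r; the event {tau > b} is
    made that small, with b as small as possible so that P (tau > u) is still
    bounded below for u < b. *)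
Lemma uniform_tail C (k : R) : 0 < C -> 0 < k -> exists b p : R,
  [/\ 0 <= b, 0 < p,
    forall u, 0 <= u < b -> (p%:E <= P0 [set v | (u < tau v)%R])%E &
    forall l, `|l| <= C ->
      (\int[P0]_w (tilt l (eta l) (tau w) (X w) * (b < tau w)%R%:R *
         ((1 + `|tau w|) / k))%:E <= (4^-1)%:E)%E].
Proof.
move=> C0 k0; have [a a0 Ha] := eta_quadratic_lower eta_norm C0.
have [K K0 HK] := tilt_envelope a0 (ltW C0).
pose D w := K / k * envelope w.
have iD : P0.-integrable setT (EFin \o D).
  exact: (integrableZl measurableT (K / k) integrable_envelope).
have q0 : 0 < 4^-1 :> R by rewrite invr_gt0 ltr0n.
have [r [r0 Hr]] := integral_normr_continuous iD q0.
have r20 : 0 < r / 2 by rewrite divr_gt0.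
have [b b0 [Pb Hb]] := tail_threshold r20.
exists b, (r / 2); split => // l lC.
pose A := [set w | (b < tau w)%R].
have mA : measurable A.
  apply: (measurable_bool_set (b := fun v : Omega0 => (b < tau v)%R)).
  by apply: measurable_fun_ltr => //; exact: measurable_cst.
have PA : (P0 A < r%:E)%E.
  by apply: (le_lt_trans Pb); rewrite lte_fin ltr_pdivrMr//; lra.
apply: (@le_trans _ _ (\int[P0]_(w in A) `|D w|%:E)%E); last first.
  have iA : P0.-integrable A (EFin \o (fun w => `|D w|)).
    apply: (integrableS measurableT) => //.
    exact: (integrable_norm iD).
  have := Hr A mA PA; rewrite -lte_fin /Rintegral fineK; first exact: ltW.
  exact: integrable_fin_num.
rewrite [leRHS]integral_mkcond; apply: ae_ge0_le_integral => //.
- by move=> w _; rewrite lee_fin !mulr_ge0 ?tilt_ge0 ?ler0n// ?invr_ge0 ?(ltW k0)// addr_ge0.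
- apply/measurable_EFinP; apply: measurable_funM.
    apply: measurable_funM => //; apply: measurable_natr_bool.
    by apply: measurable_fun_ltr => //; exact: measurable_cst.
  apply: measurable_funM; last exact: measurable_cst.
  by apply: measurable_funD; [exact: measurable_cst|exact: measurableT_comp].
- by move=> w _; rewrite patchE; case: ifP => // _; rewrite lee_fin.
- apply/(measurable_restrictT _ _).1 => //; apply/measurable_EFinP.
  apply: measurableT_comp => //; apply/measurable_EFinP.
  by case/integrableP : iD => + _; exact: measurable_funS.
- apply: filterS (HK l (eta l) lC (Ha l lC)) => w hw _.
  rewrite patchE; case: (boolP (b < tau w)) => bt; last first.
    by rewrite memNset ?mulr0 ?mul0r//; exact/negP.
  rewrite mem_set// lee_fin mulr1 mulrA ler_pdivrMr//.
  rewrite mulrC; apply: (le_trans hw).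
  apply: (@le_trans _ _ (D w * k)).
    by rewrite /D mulrAC mulfVK// gt_eqF.
  by rewrite ler_wpM2r// ?(ltW k0)// ler_norm.
Qed.

End uniform_constants.

End mgf.

(** * From the walk to the renewal-reward process *)

Section renewal_reward_bounds.
Context (R : realType) d0 (Omega0 : measurableType d0) (P0 : probability Omega0 R)
  (tau X : {RV P0 >-> R}) d (Omega : measurableType d) (P : probability Omega R)
  (taus Xs : nat -> {RV P >-> R}).
Hypothesis copies : independent_copies P0 P
     (fun w => (tau w, X w)) (fun n w => (taus n w, Xs n w)).

Lemma arrivalS n w : arrival taus n.+1 w = arrival taus n w + taus n w.
Proof. by rewrite /arrival big_ord_recr. Qed.

Lemma renewal_count_isE t w n : renewal_count_is taus t w n =
  (0 <= t - arrival taus n w < taus n w).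
Proof.
rewrite /renewal_count_is -/(arrival taus n w) -/(arrival taus n.+1 w) arrivalS.
by rewrite subr_ge0 ltrBlDl.
Qed.

Let measurable_count t n : measurable_fun setT (fun w => renewal_count_is taus t w n).
Proof.
apply: measurable_and.
- by apply: measurable_fun_ler; [exact: measurable_arrival|exact: measurable_cst].
- by apply: measurable_fun_ltr; [exact: measurable_cst|exact: measurable_arrival].
Qed.

Let first_count t n w :=
  renewal_count_is taus t w n && all (fun k => ~~ renewal_count_is taus t w k) (iota 0 n).

Let measurable_first t n : measurable_fun setT (first_count t n).
Proof.
apply: measurable_and => //.
elim: (iota 0 n) => [|k s IHs] /=; first exact: measurable_cst.
by apply: measurable_and => //; exact: measurable_neg.
Qed.

(** The process is the pointwise limit of the sums of S_n over the steps n < N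
    that are the first to satisfy the defining condition; for each outcome
    these sums are eventually constant. *)
Lemma measurable_renewal_reward t : measurable_fun setT (renewal_reward taus Xs t).
Proof.
pose f N w := \sum_(n < N) (first_count t n w)%:R * reward Xs n w.
have mf N : measurable_fun setT (f N).
  apply: measurable_sum => n; apply: measurable_funM; last exact: measurable_reward.
  exact: measurable_natr_bool.
apply: (measurable_fun_cvg mf) => w _; apply: cvg_near_cst.
rewrite /renewal_reward; case: pselect => [exn|nex]; last first.
  apply: nearW => N; rewrite /f big1// => n _.
  rewrite /first_count (_ : renewal_count_is _ _ _ _ = false) ?mul0r//.
  by apply/negbTE/negP => h; apply: nex; exists n.
case: ex_minnP => m tm mmin; exists m.+1 => // N /= mN.
have first_m n : first_count t n w = (n == m).
  rewrite /first_count; apply/idP/eqP => [/andP[tn /allP hn]|->].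
    apply/eqP; rewrite eqn_leq (mmin _ tn) andbT leqNgt; apply/negP => nm.
    by have := hn m; rewrite mem_iota/= add0n nm tm => /(_ isT).
  rewrite tm; apply/allP => k; rewrite mem_iota/= add0n => km.
  by apply/negP => /mmin; rewrite leqNgt km.
rewrite /f (bigD1 (Ordinal mN))//= first_m eqxx mul1r big1 ?addr0//.
by move=> n; rewrite first_m -val_eqE /= => /negbTE ->; rewrite mul0r.
Qed.

Lemma renewal_count_unique t w m n : (forall i, 0 < taus i w) ->
  renewal_count_is taus t w m -> renewal_count_is taus t w n -> m = n.
Proof.
move=> t0.
have mono i j : (i < j)%N -> arrival taus i.+1 w <= arrival taus j w.
  move=> ij; rewrite /arrival -(big_mkord xpredT (fun i => taus i w)).
  rewrite -(big_mkord xpredT (fun i => taus i w)) (big_cat_nat (leq0n _) ij)/= lerDl.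
  by apply: sumr_ge0 => k _; exact: ltW.
move=> /andP[m1 m2] /andP[n1 n2].
have [mn|nm|//] := ltngtP m n.
- by have := le_lt_trans (le_trans (mono _ _ mn) n1) m2; rewrite ltxx.
- by have := le_lt_trans (le_trans (mono _ _ nm) m1) n2; rewrite ltxx.
Qed.

Variables (lam eta c : R).
Hypothesis tau_gt0 : {ae P0, forall w, 0 < tau w}.
Hypothesis eta_ge0 : 0 <= eta.
Hypothesis c_gt0 : 0 < c.
Hypothesis m0_mass : (\int[P0]_v (tilt lam eta (tau v) (X v))%:E = 1)%E.
Hypothesis m0_decay :
  (\int[P0]_v (tilt lam eta (tau v) (X v) * expR (- tau v))%:E <= (1 - c)%:E)%E.

Definition gain t w := expR (lam * renewal_reward taus Xs t w).

Lemma measurable_gain t : measurable_fun setT (gain t).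
Proof.
apply: measurableT_comp; first exact: measurable_expR.
by apply: measurable_funM; [exact: measurable_cst|exact: measurable_renewal_reward].
Qed.

Local Open Scope ereal_scope.

Definition weight n w := tilt lam eta (arrival taus n w) (reward Xs n w).

(** On outcomes for which no renewal epoch qualifies the process is 0 by
    convention; the summand 1 takes care of them. *)
Lemma gain_le t w : (0 <= t)%R -> (gain t w)%:E <= (expR (eta * t))%:E *
  (1 + \sum_(n <oo) ((weight n w)%:E *
         (1 * window (taus n w) (t - arrival taus n w))%:E)).
Proof.
move=> t0.
have e1 : (1 <= expR (eta * t))%R by rewrite -expR0 ler_expR mulr_ge0.
have term0 n : 0 <= (weight n w)%:E *
         (1 * window (taus n w) (t - arrival taus n w))%:E.
  by rewrite mule_ge0// lee_fin ?tilt_ge0// mul1r ler0n.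
have s0 : 0 <= \sum_(n <oo) ((weight n w)%:E *
         (1 * window (taus n w) (t - arrival taus n w))%:E).
  exact: nneseries_ge0.
rewrite /gain /renewal_reward; case: pselect => [exn|nex]; last first.
  rewrite mulr0 expR0; apply: (@le_trans _ _ ((expR (eta * t))%:E * 1)).
    by rewrite mule1 lee_fin.
  by apply: lee_wpmul2l; [rewrite lee_fin expR_ge0|exact: leeDl].
case: ex_minnP => m tm _.
apply: (@le_trans _ _ ((expR (eta * t))%:E * ((weight m w)%:E *
         (1 * window (taus m w) (t - arrival taus m w))%:E))).
  have := tm; rewrite renewal_count_isE mul1r /window => ->.
  rewrite mule1 -EFinM lee_fin /weight /tilt -expRD ler_expR.
  have /andP[h _] := tm.
  have : (eta * arrival taus m w <= eta * t)%R by rewrite ler_wpM2l.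
  rewrite -/(reward Xs m w); lra.
apply: lee_wpmul2l; first by rewrite lee_fin expR_ge0.
apply: le_trans (leeDr _ _) => //.
apply: le_trans (nneseries_lim_ge m.+1 (fun k _ _ => term0 k)).
by rewrite big_nat_recr//=; apply: leeDr; exact: sume_ge0.
Qed.

(** Restricting to T_n > t - b costs a factor exp (eta b) only. *)
Lemma gain_ge t b w N : (0 <= t)%R -> (forall i, 0 < taus i w)%R ->
  \sum_(n < N) ((weight n w)%:E * (window b (t - arrival taus n w) *
       (t - arrival taus n w < taus n w)%R%:R)%:E) <=
  (expR (eta * (b - t)) * gain t w)%:E.
Proof.
move=> t0 tauw.
have term n : (weight n w)%:E * (window b (t - arrival taus n w) *
       (t - arrival taus n w < taus n w)%R%:R)%:E <=
    (expR (eta * (b - t)) * ((renewal_count_is taus t w n)%:R * gain t w))%:E.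
  rewrite -EFinM lee_fin renewal_count_isE /window.
  case: (lerP 0%R (t - arrival taus n w)) => u0 /=; last first.
    by rewrite !mul0r !mulr0.
  case: (ltP (t - arrival taus n w)%R b) => ub /=; last first.
    by rewrite mul0r mulr0 !mulr_ge0 ?expR_ge0// ler0n.
  case: ltP => ut /=; last by rewrite !mul0r !mulr0.
  have tn : renewal_count_is taus t w n by rewrite renewal_count_isE u0.
  rewrite !mul1r mulr1 /gain (renewal_rewardE Xs tauw tn) -/(reward Xs n w).
  rewrite /weight /tilt -expRD ler_expR.
  have : (eta * (t - arrival taus n w) <= eta * b)%R by rewrite ler_wpM2l// ltW.
  lra.
apply: (@le_trans _ _ (\sum_(n < N)
  (expR (eta * (b - t)) * ((renewal_count_is taus t w n)%:R * gain t w))%:E)).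
  by apply: lee_sum => n _; exact: term.
rewrite sumEFin lee_fin -mulr_sumr ler_wpM2l ?expR_ge0//.
rewrite -mulr_suml ler_piMl ?expR_ge0// -natr_sum lern1.
have [[m tm]|nm] := pselect (exists m : 'I_N, renewal_count_is taus t w m).
  rewrite (bigD1 m)//= tm big1// => n nm.
  apply/eqP; rewrite eqb0; apply/negP => tn.
  by move/negP: nm; apply; apply/eqP/val_inj; exact: renewal_count_unique tauw tn tm.
rewrite big1// => n _; apply/eqP; rewrite eqb0; apply/negP => tn.
by apply: nm; exists n.
Qed.

(** Positivity transfers from tau to its copies through the law. *)
Lemma taus_gt0 : {ae P, forall w, forall n, 0 < taus n w}%R.
Proof.
apply/ae_foralln => n; exists [set w | taus n w <= 0]%R.
have msub (U : measurableType _) (f : U -> R) : measurable_fun setT f ->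
    measurable [set w | f w <= 0]%R.
  move=> mf; apply: (measurable_bool_set (b := fun w => f w <= 0)%R).
  by apply: measurable_fun_ler => //; exact: measurable_cst.
split.
- by apply: msub; exact: measurable_funPT.
- have [_ /(_ n) same] := copies.
  have mA : measurable ([set x : R | x <= 0]%R `*` [set: R]).
    apply: measurableX => //; apply: (msub _ R id); exact: measurable_id.
  have := same _ mA.
  have -> : (fun w => (taus n w, Xs n w)) @^-1` ([set x : R | x <= 0]%R `*` [set: R]) =
    [set w | taus n w <= 0]%R by apply/seteqP; split=> w //= [].
  move=> E; apply: (etrans E); apply/negligibleP.
    have -> : (fun w => (tau w, X w)) @^-1` ([set x : R | x <= 0]%R `*` [set: R]) =
      [set w | tau w <= 0]%R by apply/seteqP; split=> w //= [].
    by apply: msub; exact: measurable_funPT.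
  have [M [mM M0 sub]] := tau_gt0; exists M; split => // w /= [wt _].
  by apply: sub => /=; apply/negP; rewrite -leNgt.
- by move=> w /= /negP; rewrite -leNgt.
Qed.

Let measurable_window_term n t : measurable_fun setT
  (fun w => (weight n w)%:E * (1 * window (taus n w) (t - arrival taus n w))%:E).
Proof.
apply: emeasurable_funM.
  apply/measurable_EFinP; apply: measurable_tilt;
    [exact: measurable_arrival|exact: measurable_reward].
apply/measurable_EFinP; apply: measurable_funM; first exact: measurable_cst.
apply: measurable_natr_bool.
under eq_fun do rewrite -renewal_count_isE.
exact: measurable_count.
Qed.

Lemma gain_upper t : (0 <= t)%R -> \int[P0]_v (`|tau v|)%:E = 1 ->
  \int[P]_w (gain t w)%:E <= (expR (eta * t) * (1 + 2 / c))%:E.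
Proof.
move=> t0 Etau; have mgain := measurable_gain t.
pose term n w := (weight n w)%:E * (1 * window (taus n w) (t - arrival taus n w))%:E.
have term0 n w : 0 <= term n w.
  by rewrite mule_ge0// lee_fin ?tilt_ge0// mul1r ler0n.
have mseries : measurable_fun setT (fun w => \sum_(n <oo) term n w).
  apply: (@ge0_emeasurable_sum _ _ _ setT term xpredT) => [n w _ _|n _].
    exact: term0.
  exact: measurable_window_term.
apply: (@le_trans _ _
   (\int[P]_w ((expR (eta * t))%:E * (1 + \sum_(n <oo) term n w)))).
  apply: ge0_le_integral => //.
  - by move=> w _; rewrite lee_fin expR_ge0.
  - exact/measurable_EFinP.
  - apply: emeasurable_funM; first exact: measurable_cst.
    by apply: emeasurable_funD => //; exact: measurable_cst.
  - by move=> w _; exact: gain_le.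
rewrite ge0_integralZl//; last 2 first.
- by apply: emeasurable_funD => //; exact: measurable_cst.
- by move=> w _; rewrite adde_ge0// nneseries_ge0.
rewrite EFinM; apply: lee_wpmul2l; first by rewrite lee_fin expR_ge0.
rewrite ge0_integralD//; last first.
  by move=> w _; exact: nneseries_ge0.
rewrite EFinD; apply: leeD.
  by rewrite integral_probability_cst.
rewrite integral_nneseries//; last by move=> n; exact: measurable_window_term.
apply: lime_le; first by apply: is_cvg_nneseries => n _ _; exact: integral_ge0.
apply: nearW => N; rewrite big_mkord.
have mk : measurable_fun setT (fun _ : R * R => 1%R : R) by exact: measurable_cst.
have := @sum_crossings_le _ _ _ _ tau X _ _ P taus Xs copies tau_gt0 lam eta c c_gt0
  m0_mass m0_decay t (fun=> 1%R) N mk (fun=> ler01).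
move=> /le_trans; apply.
have mabs : measurable_fun setT (fun v => `|tau v|)%R by exact: measurableT_comp.
under eq_integral do rewrite mul1r mulrC EFinM EFinD.
rewrite ge0_integralZl//; last 3 first.
- apply: emeasurable_funD; first exact: measurable_cst.
  exact/measurable_EFinP.
- by move=> v _; rewrite adde_ge0// lee_fin.
- by rewrite lee_fin invr_ge0 ltW.
rewrite ge0_integralD//; last exact/measurable_EFinP.
rewrite Etau integral_probability_cst.
by rewrite -EFinD -EFinM lee_fin mulrC.
Qed.

Lemma gain_lower t b p : (0 <= t)%R -> (0 <= b)%R -> (0 <= p)%R ->
  (forall u, (0 <= u < b)%R -> p%:E <= P0 [set v | (u < tau v)%R]) ->
  \int[P0]_v (tilt lam eta (tau v) (X v) * (b < tau v)%R%:R *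
      ((1 + `|tau v|) / c))%:E <= (4^-1)%:E ->
  (p / 2)%:E <= (expR (eta * (b - t)))%:E * \int[P]_w (gain t w)%:E.
Proof.
move=> t0 b0 p0 Hp Hbad; have mgain := measurable_gain t.
have [N HN] := @sum_crossings_ge _ _ _ _ tau X _ _ P taus Xs copies tau_gt0 lam eta c c_gt0
  m0_mass m0_decay t b p t0 b0 p0 Hp Hbad.
apply: (le_trans HN).
pose term n w := (weight n w)%:E * (window b (t - arrival taus n w) *
       (t - arrival taus n w < taus n w)%R%:R)%:E.
have term0 n w : 0 <= term n w.
  by rewrite mule_ge0// lee_fin ?tilt_ge0// mulr_ge0// ler0n.
have mterm n : measurable_fun setT (term n).
  have mu : measurable_fun setT (fun w => t - arrival taus n w)%R.
    by apply: measurable_funB; [exact: measurable_cst|exact: measurable_arrival].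
  apply: emeasurable_funM.
    apply/measurable_EFinP; apply: measurable_tilt;
      [exact: measurable_arrival|exact: measurable_reward].
  apply/measurable_EFinP; apply: measurable_funM.
    exact: (measurableT_comp (measurable_window b)).
  by apply: measurable_natr_bool; exact: measurable_fun_ltr.
apply: (@le_trans _ _
    (\int[P]_w ((expR (eta * (b - t)))%:E * (gain t w)%:E))); last first.
  rewrite ge0_integralZl//; first exact/measurable_EFinP.
  by move=> w _; rewrite lee_fin expR_ge0.
rewrite -ge0_integral_sum//; last 2 first.
- by move=> n; exact: mterm.
- by move=> n w _; exact: term0.
apply: ae_ge0_le_integral => //.
- by move=> w _; apply: sume_ge0 => n _; exact: term0.
- by apply: emeasurable_sum => n; exact: mterm.
- by move=> w _; rewrite mule_ge0// lee_fin expR_ge0.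
- apply: emeasurable_funM; [exact: measurable_cst|exact/measurable_EFinP].
- apply: filterS taus_gt0 => w tw _; rewrite -EFinM; exact: gain_ge.
Qed.

End renewal_reward_bounds.

(** * Growth rate of the exponential moments *)

Lemma normr_le_lne (R : realType) (Z : \bar R) (t e A B : R) : 0 < t ->
  0 < A -> (A%:E <= (expR (- (e * t)))%:E * Z)%E -> (Z <= (expR (e * t) * B)%:E)%E ->
  (`| t^-1%:E * lne Z - e%:E | <= ((`|ln A| + `|ln B|) / t)%:E)%E.
Proof.
move=> t0 A0 AZ ZB.
have Z0 : (0 < Z)%E.
  rewrite ltNge; apply/negP => Zle.
  have := le_trans AZ (mule_ge0_le0 (ltW _ : (0 <= (expR (- (e * t)))%:E)%E) Zle).
  rewrite lee_fin leNgt A0 => H; apply: notF; apply: H.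
  by rewrite lte_fin expR_gt0.
case: Z Z0 AZ ZB => [z| |]//.
rewrite lte_fin -EFinM !lee_fin => z0 Az zB.
have B0 : 0 < B.
  by have := lt_le_trans z0 zB; rewrite pmulr_rgt0 ?expR_gt0.
rewrite lne_EFin// -EFinM -EFinB abse_EFin lee_fin.
have h1 : e * t + ln A <= ln z.
  rewrite -ler_expR expRD !lnK ?posrE//.
  have := ler_wpM2l (expR_ge0 (e * t)) Az.
  by rewrite mulrA -expRD subrr expR0 mul1r.
have h2 : ln z <= e * t + ln B.
  by rewrite -ler_expR expRD !lnK ?posrE.
have -> : t^-1 * ln z - e = (ln z - e * t) / t by field; rewrite gt_eqF.
rewrite normrM [X in _ * X]gtr0_norm ?invr_gt0// ler_wpM2r ?invr_ge0 ?(ltW t0)//.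
have hA := ler_norm (- ln A); rewrite normrN in hA.
have hB := ler_norm (ln B).
have := normr_ge0 (ln A); have := normr_ge0 (ln B).
rewrite ler_norml; lra.
Qed.

Theorem theorem3 (R : realType)
  (d0 : measure_display) (Omega0 : measurableType d0) (P0 : probability Omega0 R)
  (tau X : {RV P0 >-> R})
  (d : measure_display) (Omega : measurableType d) (P : probability Omega R)
  (taus Xs : nat -> {RV P >-> R})
  (copies : independent_copies P0 P
     (fun w => (tau w, X w)) (fun n w => (taus n w, Xs n w)))
  (tau_gt0 : {ae P0, forall w, 0 < tau w})
  (exp_moment : exists2 eps : R, 0 < eps &
     ('E_P0[fun w => expR (eps * X w ^+ 2 - tau w)] < +oo)%E)
  (EX : ('E_P0[X] = 0)%E)
  (EX2 : ('E_P0[fun w => (X w ^+ 2)%R] = 1)%E)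
  (Etau : ('E_P0[tau] = 1)%E) :
  exists eta : R -> R,
    [/\ forall lam : R,
          unique (fun e : R => 0 <= e /\
            ('E_P0[fun w => expR (lam * X w - e * tau w)] = 1)%E) (eta lam),
        (eta : R -> R^o) = (fun lam => 2^-1 * lam ^+ 2)
          +o_ (0 : R) (fun lam : R => (lam ^+ 2 : R^o))
      & forall C : R, 0 < C ->
          exists TT K : R, [/\ 0 < TT, 0 < K &
            forall t lam : R, TT <= t -> - C <= lam <= C ->
              (`| t^-1%:E *
                  lne 'E_P[fun w => expR (lam * renewal_reward taus Xs t w)]
                  - (eta lam)%:E | <= (K / t)%:E)%E ]].
Proof.
move: exp_moment EX EX2 Etau; rewrite !unlock => -[eps eps0 Hexp] HX HX2 Htau.
have Habs : (\int[P0]_v (`|tau v|)%:E = 1)%E.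
  rewrite -[RHS]Htau; apply: ae_eq_integral => //.
  - by apply/measurable_EFinP; exact: measurableT_comp.
  - by apply/measurable_EFinP.
  - by apply: filterS tau_gt0 => w t0 _; rewrite gtr0_norm.
have /choice[eta eta_norm] : forall l, exists e, normalizing tau X l e.
  by move=> l; exact: (normalizing_exists tau_gt0 eps0 Hexp HX HX2 Htau).
exists eta; split.
- move=> l; split; first exact: (normalizingP tau X l (eta l)).2 (eta_norm l).
  move=> e /(normalizingP tau X l e).1 he.
  exact: (normalizing_unique tau_gt0 (eta_norm l) he).
- apply/eqaddoP => e e0.
  have [dl dl0 H] := eta_near0 tau_gt0 eps0 Hexp HX HX2 Htau eta_norm e0.
  apply/nbhs_ballP; exists dl => //= l; rewrite -ball_normE /ball_/= sub0r normrN.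
  by move=> ldl; rewrite [X in _ <= _ * X]ger0_norm ?sqr_ge0//; exact: H.
- move=> C C0.
  have [B B0 HB] := eta_bounded tau_gt0 eta_norm C0.
  have [c c0 Hc] := uniform_decay tau_gt0 eta_norm C0.
  have [b [p [b0 p0 Hp Hb]]] :=
    uniform_tail tau_gt0 eps0 Hexp HX HX2 Htau eta_norm C0 c0.
  exists 1, (B * b + `|ln (p / 2)| + `|ln (1 + 2 / c)| + 1); split=> //.
    by rewrite ltr_wpDl// !addr_ge0// mulr_ge0.
  move=> t l t1 lC.
  have nlC : `|l| <= C by rewrite ler_norml.
  have t0 : 0 < t by apply: lt_le_trans t1.
  have [eta0 eta_mass] := (normalizingP tau X l (eta l)).2 (eta_norm l).
  have up := gain_upper copies tau_gt0 eta0 c0 eta_mass (Hc l nlC) (ltW t0) Habs.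
  have low := gain_lower copies tau_gt0 eta0 c0 eta_mass (Hc l nlC) (ltW t0) b0
    (ltW p0) Hp (Hb l nlC).
  have p20 : 0 < p / 2 by rewrite divr_gt0.
  have A0 : 0 < p / 2 * expR (- (eta l * b)) by rewrite mulr_gt0 ?expR_gt0.
  apply: le_trans (normr_le_lne t0 A0 _ up) _.
    have := lee_wpmul2r (_ : (0 <= (expR (- (eta l * b)))%:E)%E) low.
    rewrite -EFinM => /(_ _)/le_trans; apply; first by rewrite lee_fin expR_ge0.
    rewrite -muleA muleC -muleA -EFinM -expRD muleC.
    by rewrite (_ : - (eta l * b) + _ = - (eta l * t)) //; ring.
  rewrite lee_fin ler_wpM2r ?invr_ge0 ?(ltW t0)//.
  rewrite lnM ?posrE ?expR_gt0// expRK.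
  have etab : `|- (eta l * b)| <= B * b.
    by rewrite normrN ger0_norm ?mulr_ge0// ler_wpM2r// HB.
  have := ler_normD (ln (p / 2)) (- (eta l * b)); lra.
Qed.
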